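(* There are universal constants $C_0,C,c>0$ such that the following holds. Let $n\ge5$, let $Q\subset\mathbb{R}^n$ be an unconditional convex body, let $r>0$ and $L\ge C_0r$. Then the diagonal $Q$-cylinder $K=K_{L,r}^Q$ contains $(r/2)Q$ and is contained in $(L+r)Q$. In addition, there exist axis-disjoint sets $A,B\subset K$ such that $$\min\{\operatorname{vol}(A),\operatorname{vol}(B)\}\ge c\operatorname{vol}(K)\qquad\text{and}\qquad \frac{\operatorname{vol}(K\setminus(A\cup B))}{\min\{\operatorname{vol}(A),\operatorname{vol}(B)\}}\le\frac{Cr}{nL}.$$
   Context: All sets are Borel. A convex body $Q\subset\mathbb{R}^n$ (compact, convex, nonempty interior) is unconditional if it is invariant under arbitrary sign changes of the coordinates; its norm is $\|z\|_Q=\inf\{a>0:z\in aQ\}$. For a symmetric convex body $B$ and a linear functional $\varphi$, $\|\varphi\|_{B^*}=\sup_{x\in B}|\varphi(x)|$. Two sets are axis-disjoint if every point of one differs from every point of the other in at least two coordinates. Construction of the cylinder. Let $\sigma_i(Q)^2=\frac1{\operatorname{vol}(Q)}\int_Qx_i^2\,dx$, $\Lambda_Q=\operatorname{diag}(\sigma_1(Q)^{-1},\dots,\sigma_n(Q)^{-1})$, $\widehat Q=\Lambda_QQ$. Let $\mathbf 1=(1,\dots,1)$, $q_Q=\|\mathbf 1\|_{\widehat Q}$, $\widehat a_Q=q_Q^{-1}\mathbf 1$. Choose a linear functional $\widehat\ell_Q$ with $\|\widehat\ell_Q\|_{\widehat Q^*}=1$ and $\widehat\ell_Q(\widehat a_Q)=1$.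 Set $a_Q=\Lambda_Q^{-1}\widehat a_Q$, $\ell_Q=\widehat\ell_Q\circ\Lambda_Q$, $H_Q=\ker\ell_Q$, $F_Q=Q\cap H_Q$. Then $$K_{L,r}^Q=[-L,L]a_Q+rF_Q=\{ta_Q+rv:\ -L\le t\le L,\ v\in F_Q\}.$$ *)

(* Defs.v *)
From HB Require Import structures.
From mathcomp Require Import all_boot all_order all_algebra.
From mathcomp Require Import all_classical all_reals all_analysis.

Set Implicit Arguments.
Unset Strict Implicit.
Unset Printing Implicit Defensive.
Import Order.TTheory GRing.Theory Num.Theory.
Import numFieldNormedType.Exports.

Local Open Scope classical_set_scope.
Local Open Scope ring_scope.

(* R^n is 'rV[R]_n with its usual topology; borelRV R n is the same carrier
   with the sigma-algebra generated by the open sets. *)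
Definition borelRV (R : realType) (n : nat) :=
  g_sigma_algebraType (@open 'rV[R]_n).

HB.instance Definition _ (R : realType) (n : nat) :=
  Measurable.on (borelRV R n).

Section lebesgue_rV.
Context {R : realType}.

(* The identification R * R^n = R^(n+1), (x, v) |-> (x, v_0, ..., v_(n-1)). *)
Definition consRV n (p : measurableTypeR R * borelRV R n) : borelRV R n.+1 :=
  \row_(i < n.+1)
    (if unlift ord0 i is Some j then (p.2 : 'rV[R]_n) 0 j else p.1).

Definition unconsRV n (x : borelRV R n.+1) : measurableTypeR R * borelRV R n :=
  ((x : 'rV[R]_n.+1) 0 ord0,
   \row_(j < n) (x : 'rV[R]_n.+1) 0 (lift ord0 j)).

Lemma consRVK n : cancel (@consRV n) (@unconsRV n).
Proof.
move=> [x v]; rewrite /unconsRV /consRV; congr pair.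
  by rewrite mxE unlift_none.
by apply/rowP => j; rewrite !mxE liftK.
Qed.

Lemma unconsRVK n : cancel (@unconsRV n) (@consRV n).
Proof.
move=> x; apply/rowP => i; rewrite mxE.
by case: unliftP => [j|] ->; rewrite ?mxE.
Qed.

Lemma open_measurable_rV n (U : set 'rV[R]_n) :
  open U -> measurable (U : set (borelRV R n)).
Proof. by move=> oU; apply: sub_sigma_algebra. Qed.

Lemma measurable_consRV n : measurable_fun [set: _] (@consRV n).
Proof.
apply: measurability => // _ [U oU <-]; rewrite setTI.
pose D : set (rat * 'rV[rat]_n * nat) := [set q |
  ball (ratr q.1.1 : R) (q.2.+1%:R^-1) `*`
  ball (map_mx ratr q.1.2 : 'rV[R]_n) (q.2.+1%:R^-1) `<=` @consRV n @^-1` U].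
pose F q : set (measurableTypeR R * borelRV R n) :=
  if q \in D then ball (ratr q.1.1 : R) (q.2.+1%:R^-1) `*`
  ball (map_mx ratr q.1.2 : 'rV[R]_n) (q.2.+1%:R^-1) else set0.
rewrite (_ : _ @^-1` _ = \bigcup_q F q); last first.
  apply/seteqP; split => [[x v] /= Uxv|[x v] [q _]]; last first.
    by rewrite /F; case: ifPn => // /set_mem; apply.
  have /nbhs_ballP[e /= e0 eU] : nbhs (consRV (x, v) : 'rV[R]_n.+1) U.
    exact: open_nbhs_nbhs.
  have e20 : 0 < e / 2 by rewrite divr_gt0.
  pose k := Num.trunc (e / 2)^-1.
  have k0 : 0 < k.+1%:R^-1 :> R by rewrite invr_gt0.
  have ke : k.+1%:R^-1 < e / 2.
    rewrite -[ltRHS]invrK ltf_pV2 ?posrE ?invr_gt0//.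
    exact: truncnS_gt.
  have rat_near (y : R) : exists q : rat, `|ratr q - y| < k.+1%:R^-1.
    have /rat_in_itvoo[q] : y - k.+1%:R^-1 < y + k.+1%:R^-1.
      by rewrite ltrD2l gt0_cp.
    by rewrite in_itv/= => ?; exists q; rewrite ltr_distl.
  have [q qx] := rat_near x.
  have [w wv] := choice (fun j => rat_near (v 0 j)).
  exists (q, \row_j w j, k) => //=.
  have wv' i j : `|map_mx ratr (\row_j w j : 'rV[rat]_n) i j - v i j| < k.+1%:R^-1.
    by rewrite !mxE ord1.
  rewrite /F ifT; first by split => //=; split.
  apply/mem_set => -[y u] [/= yq [_ uw]]; apply: eU; split => // i j.
  rewrite !mxE; case: unliftP => [j'|] _ /=.
    rewrite /ball/= (splitr e) -(subrKA (map_mx ratr (\row_j w j : 'rV[rat]_n) 0 j')).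
    rewrite (le_lt_trans (ler_normD _ _))// ltrD//.
      by rewrite distrC (lt_trans (wv' _ _)).
    by rewrite (lt_trans (uw _ _)).
  rewrite /ball/= (splitr e) -(subrKA (ratr q)).
  rewrite (le_lt_trans (ler_normD _ _))// ltrD//.
    by rewrite distrC (lt_trans qx).
  by rewrite (lt_trans yq).
apply: countable_bigcupT_measurable => // -[[q w] k]; rewrite /F; case: ifP => // _.
apply: measurableX.
- by apply: measurable_realfun.open_measurable; exact: ball_open.
- by apply: open_measurable_rV; exact: ball_open.
Qed.

Lemma measurable_unconsRV n : measurable_fun [set: _] (@unconsRV n).
Proof.
apply/measurable_fun_pairP; split.
  apply: (measurability _ (measurable_realfun.RGenOpens.measurableE R)).
  move=> _ [_ [a [b ->]] <-]; rewrite setTI.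
  apply: open_measurable_rV; have /continuousP := @coord_continuous R 1 n.+1 0 ord0.
  by apply; exact: interval_open.
apply: measurability => // _ [U oU <-]; rewrite setTI.
apply: open_measurable_rV.
suff : open [set x : 'rV[R]_n.+1 | U (unconsRV x).2] by [].
rewrite openE => x /= Ux; rewrite /interior.
have /nbhs_ballP[e /= e0 eU] : nbhs (unconsRV x).2 U by exact: open_nbhs_nbhs.
apply/nbhs_ballP; exists e => //= y [_ yx]; apply: eU; split => // i j.
by rewrite !mxE; exact: yx.
Qed.

Section cons_measure.
Variables (n : nat) (m : {sigma_finite_measure set (borelRV R n) -> \bar R}).

Definition lebesgue_cons :=
  pushforward (lebesgue_measure \x m)%E (@consRV n).

Let lebesgue_cons0 : lebesgue_cons set0 = 0%E.
Proof. by rewrite /lebesgue_cons/pushforward preimage_set0 measure0. Qed.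

Let lebesgue_cons_ge0 A : (0 <= lebesgue_cons A)%E.
Proof. by rewrite /lebesgue_cons/pushforward; exact: measure_ge0. Qed.

Let lebesgue_cons_sigma_additive : semi_sigma_additive lebesgue_cons.
Proof.
have mpre B : measurable B -> measurable (@consRV n @^-1` B).
  by move=> mB; rewrite -[X in measurable X]setTI; exact: measurable_consRV.
move=> F mF tF mUF; rewrite /lebesgue_cons/pushforward preimage_bigcup.
apply: measure_semi_sigma_additive.
- by move=> k; exact: mpre.
- by apply/trivIsetP => i j _ _ ij; rewrite -preimage_setI;
    move/trivIsetP : tF => /(_ _ _ _ _ ij) ->//; rewrite preimage_set0.
- by rewrite -preimage_bigcup; exact: mpre.
Qed.

HB.instance Definition _ := isMeasure.Build _ _ _ lebesgue_cons
  lebesgue_cons0 lebesgue_cons_ge0 lebesgue_cons_sigma_additive.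

Let lebesgue_cons_sigma_finite : sigma_finite setT lebesgue_cons.
Proof.
have /sigma_finiteP[F [TF ndF Foo]] := sigma_finiteT (@lebesgue_measure R).
have /sigma_finiteP[G [TG ndG Goo]] := sigma_finiteT m.
exists (fun k => @unconsRV n @^-1` (F k `*` G k)).
  apply/esym/seteqP; split => // x _.
  have [i _ Fi] : (\bigcup_i F i) (unconsRV x).1 by rewrite -TF.
  have [j _ Gj] : (\bigcup_i G i) (unconsRV x).2 by rewrite -TG.
  exists (maxn i j) => //; split.
    by move: Fi; exact/subsetPset/ndF/leq_maxl.
  by move: Gj; exact/subsetPset/ndG/leq_maxr.
move=> k; have [mF Fk] := Foo k; have [mG Gk] := Goo k; split.
  rewrite -[X in measurable X]setTI.
  by apply: measurable_unconsRV => //; exact: measurableX.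
rewrite /lebesgue_cons/pushforward -comp_preimage.
rewrite (_ : _ \o _ = id); last by apply/funext => p; exact: consRVK.
by rewrite product_measure1E// lte_mul_pinfty// ge0_fin_numE.
Qed.

HB.instance Definition _ := Measure_isSigmaFinite.Build _ _ _ lebesgue_cons
  lebesgue_cons_sigma_finite.
End cons_measure.

(* n-dimensional Lebesgue measure on the Borel sets of R^n, as the iterated
   product of the one-dimensional one; lebesgue_rV_box below gives its values
   on boxes, which determine it. *)
Fixpoint lebesgue_rV n : {sigma_finite_measure set (borelRV R n) -> \bar R} :=
  if n is n'.+1 then lebesgue_cons (lebesgue_rV n') else
  dirac (0 : borelRV R 0).

Lemma measurable_box n (a b : 'rV[R]_n) :
  measurable ([set x | forall i, a 0 i <= x 0 i <= b 0 i] : set (borelRV R n)).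
Proof.
have E : [set x : 'rV[R]_n | forall i, a 0 i <= x 0 i <= b 0 i] =
    \bigcap_(i in [set: 'I_n])
      ((fun x : 'rV[R]_n => x 0 i) @^-1` `[a 0 i, b 0 i]).
  apply/seteqP; split => x /= h i.
    by move=> _; have := h i; rewrite /= in_itv.
  by have := h i Logic.I; rewrite /= in_itv.
rewrite [X in measurable X]E; apply: fin_bigcap_measurable => // i _.
have cl : closed ((fun x : 'rV[R]_n => x 0 i) @^-1` `[a 0 i, b 0 i]).
  apply: preimage_closed; last exact: interval_closed.
  by move=> x _; exact: coord_continuous.
rewrite -[X in measurable X]setCK; apply: measurableC.
exact: open_measurable_rV (closed_openC cl).
Qed.

Lemma lebesgue_rV_box n (a b : 'rV[R]_n) : (forall i, a 0 i <= b 0 i) ->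
  lebesgue_rV n [set x | forall i, a 0 i <= x 0 i <= b 0 i] =
  (\prod_(i < n) (b 0 i - a 0 i))%:E.
Proof.
elim: n a b => [|n IHn] a b ab /=.
  by rewrite big_ord0 diracE mem_set// => -[].
pose tl (x : 'rV[R]_n.+1) : 'rV[R]_n := \row_j x 0 (lift ord0 j).
have E : @consRV n @^-1`
    [set x : 'rV[R]_n.+1 | forall i, a 0 i <= x 0 i <= b 0 i] =
    `[a 0 ord0, b 0 ord0] `*`
    [set x : 'rV[R]_n | forall i, tl a 0 i <= x 0 i <= tl b 0 i].
  apply/seteqP; split => [[x v] /= h|[x v] [/= + h] i].
    split => [|j]; first by have := h ord0; rewrite mxE unlift_none in_itv.
    by have := h (lift ord0 j); rewrite !mxE liftK.
  rewrite in_itv/= => xab; rewrite mxE; case: unliftP => [j|] ->//.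
  by have := h j; rewrite !mxE.
rewrite /lebesgue_cons/pushforward [X in (_ \x _)%E X]E.
rewrite product_measure1E; [|exact: measurable_itv|exact: measurable_box].
rewrite IHn => [|j]; last by rewrite !mxE.
rewrite big_ord_recl EFinM; congr (_ * _)%E; last first.
  by congr EFin; apply: eq_bigr => j _; rewrite !mxE.
apply: etrans (lebesgue_measure_itv `[a 0 ord0, b 0 ord0]) _ => /=.
rewrite lte_fin; case: ltgtP (ab ord0) => // -> _.
by rewrite subrr.
Qed.

End lebesgue_rV.

Section cylinder.
Context {R : realType} {n : nat}.
Implicit Types (Q A B : set 'rV[R]_n).

Definition borel A := measurable (A : set (borelRV R n)).

Definition vol A : \bar R := lebesgue_rV n A.

Definition dilate (a : R) Q : set 'rV[R]_n := [set a *: x | x in Q].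

Definition convex_body Q := [/\ compact Q, convex_set Q & Q° !=set0].

Definition unconditional Q := forall s : {ffun 'I_n -> bool},
  [set \row_i ((-1) ^+ s i * x 0 i) | x in Q] = Q.

(* ||z||_Q, the infimum of the a > 0 such that z belongs to aQ. *)
Definition gauge Q (z : 'rV[R]_n) : R := inf [set a : R | 0 < a /\ dilate a Q z].

(* ||phi||_(Q^* ); the real sup is meaningful since Q is compact and nonempty
   wherever this is used. *)
Definition dual_norm Q (phi : 'rV[R]_n -> R) : R :=
  sup [set `|phi x| | x in Q].

Definition axis_disjoint A B := forall x y, A x -> B y ->
  (2 <= #|[pred i | (x 0 i != y 0 i)%R]|)%N.

Definition sigma Q (i : 'I_n) : R :=
  Num.sqrt ((fine (vol Q))^-1 *
            \int[lebesgue_rV n]_(x in Q) ((x : 'rV[R]_n) 0 i ^+ 2)).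

(* Vectors are rows, so Lambda Q acts by x |-> x *m Lambda Q. *)
Definition Lambda Q : 'M[R]_n := diag_mx (\row_i (sigma Q i)^-1).

Definition hat Q : set 'rV[R]_n := [set x *m Lambda Q | x in Q].

Definition ahat Q : 'rV[R]_n := (gauge (hat Q) (const_mx 1))^-1 *: const_mx 1.

(* The functional chosen in the construction is not unique in general; the
   cylinder therefore takes it as an argument. The functional l_Q is
   x |-> lhat (x *m Lambda Q). *)
Definition norming_functional Q (lhat : {scalar 'rV[R]_n}) :=
  dual_norm (hat Q) lhat = 1 /\ lhat (ahat Q) = 1.

(* a_Q *)
Definition axis Q : 'rV[R]_n := ahat Q *m invmx (Lambda Q).

(* F_Q *)
Definition base Q (lhat : {scalar 'rV[R]_n}) : set 'rV[R]_n :=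
  Q `&` [set x | lhat (x *m Lambda Q) = 0].

Definition cylinder Q (lhat : {scalar 'rV[R]_n}) (L r : R) : set 'rV[R]_n :=
  [set t *: axis Q + r *: v | t in `[- L, L]%classic & v in base Q lhat].

End cylinder.

(* Main.v *)
(* Membership of x in the cylinder is |ell x| <= L together with a condition on
   the component of x along the kernel of ell. Let N x be the number of negative
   coordinates of x. Changing one coordinate moves N by at most 1, so {N > k} and
   {N < k} are axis-disjoint, and what is left over in K is the layer {N = k}.
   Every layer with n/10 < k < n - n/10 lies in the slab |ell x| <= c r for a
   universal c: this slab has at most an O(r/L) fraction of the volume of K because
   O(L/r) disjoint translates of it fit in K, and one of the O(n) disjoint layers
   has at most the average volume.

   The slab bound needs that no point v of Q has more than n/10 coordinates with
   q |v_i| / sigma_i large, q being the norm of (1, ..., 1). This follows from two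
   facts.
   - sum_i |v_i| / sigma_i <= 8n/3 on Q: contracting the positive part of Q towards
     v by the factor 1 - e leaves uncovered a fraction at most n e of its volume, which
     contains the almost disjoint slabs {0 <= y_i < e v_i}, of relative volume
     at least 3/8 e v_i / sigma_i.
   - q <= 16: by the Brunn-Minkowski inequality the tails of |y_i| on Q decay
     geometrically, so |y_i| >= sigma_i / 2 on at least an eighth of Q, while the
     norming functional is at most 1 on Q. *)
Require Import Defs.
From HB Require Import structures.
From mathcomp Require Import all_boot all_order all_algebra.
From mathcomp Require Import all_classical all_reals all_analysis.
From mathcomp Require Import measurable_realfun zify ring lra.
Set Implicit Arguments.
Unset Strict Implicit.
Unset Printing Implicit Defensive.

Import Order.TTheory GRing.Theory Num.Theory.
Import numFieldNormedType.Exports.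
Local Open Scope classical_set_scope.
Local Open Scope ring_scope.

(** * Sections and diagonal affine changes of variables *)

Lemma continuous_rV (R : realType) (T : topologicalType) (n : nat)
    (f : T -> 'rV[R]_n) :
  (forall i, continuous (fun x => f x 0 i)) -> continuous f.
Proof.
move=> cf x A [P Px PA]; rewrite /nbhs/=.
have : \forall y \near x, forall i, P 0 i (f y 0 i).
  by apply: filter_forall => i; apply: cf; exact: Px.
by apply: filterS => y Py; apply: PA => i j; rewrite ord1.
Qed.

Lemma borel_preimage (R : realType) (m n : nat) (f : 'rV[R]_m -> 'rV[R]_n)
    (A : set 'rV[R]_n) : continuous f -> borel A -> borel (f @^-1` A).
Proof.
move=> /continuousP cf mA.
have mf : measurable_fun [set: borelRV R m] (f : borelRV R m -> borelRV R n).
  apply: measurability => // _ [U oU <-]; rewrite setTI.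
  by apply: open_measurable_rV; exact: cf.
by rewrite /borel -[X in measurable X]setTI; exact: mf.
Qed.

Lemma borel_closed (R : realType) (n : nat) (A : set 'rV[R]_n) :
  closed A -> borel A.
Proof.
move=> cA; rewrite /borel -[X in measurable X]setCK; apply: measurableC.
exact: open_measurable_rV (closed_openC cA).
Qed.

Lemma borel_coord_le (R : realType) (n : nat) (i : 'I_n) (a : R) :
  borel [set x : 'rV[R]_n | a <= x 0 i].
Proof.
apply: borel_closed.
apply: (@preimage_closed _ _ (fun x : 'rV[R]_n => x 0 i) [set y | a <= y]).
  by move=> x _; exact: coord_continuous.
exact: closed_ge.
Qed.

Lemma borel_coord_lt (R : realType) (n : nat) (i : 'I_n) (a : R) :
  borel [set x : 'rV[R]_n | x 0 i < a].
Proof.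
have -> : [set x : 'rV[R]_n | x 0 i < a] = ~` [set x : 'rV[R]_n | a <= x 0 i].
  by apply/seteqP; split => x /=; rewrite ltNge => /negP.
by rewrite /borel; apply: measurableC; exact: borel_coord_le.
Qed.

Definition orthant (R : realType) (n : nat) : set 'rV[R]_n :=
  [set x | forall i, 0 <= x 0 i].
Arguments orthant {R n}.

Lemma borel_orthant (R : realType) (n : nat) : borel (@orthant R n).
Proof.
have -> : @orthant R n =
    \bigcap_(i in [set: 'I_n]) [set x : 'rV[R]_n | 0 <= x 0 i].
  by apply/seteqP; split => x /= h i; [move=> _|]; apply: h.
rewrite /borel; apply: fin_bigcap_measurable => // i _.
exact: borel_coord_le.
Qed.

Section sections.
Context {R : realType} {n : nat}.

Definition sect (A : set 'rV[R]_n.+1) (s : R) : set 'rV[R]_n :=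
  [set v | A (consRV (s, v))].

Lemma consRV0 (s : R) (v : 'rV[R]_n) :
  (consRV (s, v) : 'rV[R]_n.+1) 0 ord0 = s.
Proof. by rewrite mxE unlift_none. Qed.

Lemma consRV_lift (s : R) (v : 'rV[R]_n) j :
  (consRV (s, v) : 'rV[R]_n.+1) 0 (lift ord0 j) = v 0 j.
Proof. by rewrite mxE liftK. Qed.

Lemma sectE (A : set 'rV[R]_n.+1) s :
  sect A s = xsection (@consRV R n @^-1` A) s.
Proof. by apply/seteqP; split => v; rewrite /xsection /= inE. Qed.

Let measurable_preim (A : set 'rV[R]_n.+1) : borel A ->
  measurable (@consRV R n @^-1` A).
Proof.
by move=> mA; rewrite -[X in measurable X]setTI; exact: measurable_consRV.
Qed.

Lemma borel_sect (A : set 'rV[R]_n.+1) s : borel A -> borel (sect A s).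
Proof.
by move=> mA; rewrite sectE; apply: measurable_xsection; exact: measurable_preim.
Qed.

Lemma measurable_vol_sect (A : set 'rV[R]_n.+1) : borel A ->
  @measurable_fun _ _ (measurableTypeR R) (\bar R) setT (fun s => vol (sect A s)).
Proof.
move=> mA; under eq_fun do rewrite sectE.
by apply: measurable_fun_xsection; exact: measurable_preim.
Qed.

(** The measure in dimension n + 1 is by definition the pushforward of a product measure under
    [consRV], so this is an unfolding. The inductions on the dimension below rest on it. *)
Lemma vol_sect (A : set 'rV[R]_n.+1) : borel A ->
  (vol A = \int[lebesgue_measure]_s vol (sect A s))%E.
Proof.
move=> mA; rewrite /vol /= /lebesgue_cons /pushforward /product_measure1.
by apply: eq_integral => s _; rewrite sectE.
Qed.

End sections.

Section one_dim.
Context {R : realType}.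
Notation mu := (@lebesgue_measure R).
Local Open Scope ereal_scope.

(** The measure [a] times the pushforward of [mu] under x |-> a x + b has the right values on
    half-open intervals, hence equals [mu] by uniqueness of Lebesgue measure. *)
Lemma integral_affine (a b : R) (f : R -> \bar R) : (0 < a)%R ->
  measurable_fun [set: measurableTypeR R] f -> (forall x, 0 <= f x) ->
  \int[mu]_x f (a * x + b)%R = (a^-1)%:E * \int[mu]_x f x.
Proof.
move=> a0 mf f0.
pose phi (x : measurableTypeR R) : measurableTypeR R := (a * x + b)%R.
have cphi : continuous (phi : R -> R).
  move=> x; apply: cvgD; last exact: cvg_cst.
  by apply: cvgM; [exact: cvg_cst|exact: cvg_id].
have mphi : measurable_fun [set: measurableTypeR R] phi.
  exact: continuous_measurable_fun.
have ai0 : (0 <= a)%R by exact: ltW.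
pose m' := mscale (NngNum ai0) (pushforward mu phi).
pose m := m' mphi.
have mE (A : set (measurableTypeR R)) : measurable A -> mu A = m A.
  move=> mA; apply: lebesgue_measure_unique => // _ [[c d] _ <-].
  transitivity (a%:E * mu (phi @^-1` `]c, d])); last by [].
  have -> : phi @^-1` `]c, d] = `]((c - b) / a)%R, ((d - b) / a)%R]%classic.
    apply/seteqP; split => x; rewrite /= !in_itv/= ltr_pdivrMr// ler_pdivlMr//;
    by rewrite /phi ltrBlDr lerBrDr (mulrC x).
  rewrite [LHS]lebesgue_measure_itv/= lebesgue_measure_itv/=.
  rewrite !lte_fin ltr_pM2r ?invr_gt0// ltrD2r; case: ifPn => _; last by rewrite mule0.
  rewrite -!EFinB -EFinM; congr (_%:E); field; exact: lt0r_neq0.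
transitivity (\int[pushforward mu phi]_x f x).
  by rewrite ge0_integral_pushforward.
have -> : \int[mu]_x f x = \int[m]_x f x.
  by apply: eq_measure_integral => A mA _; exact: mE.
rewrite ge0_integral_mscale//= muleA -EFinM mulVf ?mul1e//.
exact: lt0r_neq0.
Qed.

Lemma integral_even (f : R -> \bar R) :
  measurable_fun [set: measurableTypeR R] f -> (forall x, 0 <= f x) ->
  (forall x, f (- x)%R = f x) ->
  \int[mu]_x f x = 2%:E * \int[mu]_(x in `[0%R, +oo[) f x.
Proof.
move=> mf f0 fN.
have -> : [set: R] = `]-oo, 0%R[%classic `|` `[0%R, +oo[%classic.
  by rewrite -setCitvr setvU.
rewrite ge0_integral_setU//=; last 2 first.
  exact: measurable_funTS.
  rewrite disj_set2E; apply/eqP; rewrite -subset0 => x/=.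
  by rewrite !in_itv/= andbT ltNge => -[/negP].
rewrite mule_natl mule2n; congr +%E.
rewrite ge0_integration_by_substitution0// integral_itv_bndo_bndc//.
- by apply: eq_integral => x _; rewrite fN.
- exact: measurable_funTS.
Qed.

End one_dim.

Definition affine_rV (R : realType) n (c b x : 'rV[R]_n) : 'rV[R]_n :=
  \row_i (c 0 i * x 0 i + b 0 i).

Lemma continuous_affine_rV (R : realType) n (c b : 'rV[R]_n) :
  continuous (affine_rV c b).
Proof.
apply: continuous_rV => i; under eq_fun do rewrite mxE.
move=> x; apply: (@continuousD R R^o _ (fun x : 'rV[R]_n => c 0 i * x 0 i)
  (fun=> b 0 i)); last exact: cst_continuous.
by apply: (@continuousM R _ (fun=> c 0 i) (fun x : 'rV[R]_n => x 0 i));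
  [exact: cst_continuous|exact: coord_continuous].
Qed.

(** A diagonal affine map carries sections to sections, so induction on the dimension leaves only a
    substitution in the first coordinate. *)
Lemma vol_affine (R : realType) n (c b : 'rV[R]_n) (A : set 'rV[R]_n) :
  (forall i, 0 < c 0 i) -> borel A ->
  (vol (affine_rV c b @^-1` A) = (\prod_i c 0 i)^-1%:E * vol A)%E.
Proof.
elim: n c b A => [|n IHn] c b A c0 mA.
  rewrite big_ord0 invr1 mul1e; congr vol; apply/seteqP; split => x /=;
  by rewrite (_ : affine_rV c b x = x)//; apply/rowP => -[].
have mpre := borel_preimage (@continuous_affine_rV R _ c b) mA.
pose tl (x : 'rV[R]_n.+1) : 'rV[R]_n := \row_j x 0 (lift ord0 j).
have secE s : sect (affine_rV c b @^-1` A) s =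
    affine_rV (tl c) (tl b) @^-1` sect A (c 0 ord0 * s + b 0 ord0).
  have uE v : affine_rV c b (consRV (s, v)) =
      consRV (c 0 ord0 * s + b 0 ord0, affine_rV (tl c) (tl b) v).
    by apply/rowP => i; rewrite !mxE; case: unliftP => [j|] ->; rewrite ?mxE.
  by apply/seteqP; split => v; rewrite /sect /= uE.
rewrite (vol_sect mpre) (vol_sect mA).
under eq_integral => s _.
  rewrite secE IHn; last 2 first.
  - by move=> i; rewrite mxE.
  - exact: borel_sect.
  over.
rewrite /= ge0_integralZl//; last 2 first.
- apply: (measurableT_comp (measurable_vol_sect mA)) => //.
  apply: continuous_measurable_fun => x; apply: cvgD; last exact: cvg_cst.
  by apply: cvgM; [exact: cvg_cst|exact: cvg_id].
- by rewrite lee_fin invr_ge0 prodr_ge0// => i _; rewrite mxE ltW.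
rewrite (@integral_affine R (c 0 ord0) (b 0 ord0) (fun s => vol (sect A s)))//.
  rewrite muleA -EFinM -invfM mulrC big_ord_recl; congr (_^-1%:E * _)%E.
  by congr (_ * _); apply: eq_bigr => i _; rewrite mxE.
exact: measurable_vol_sect.
Qed.

(** Invariance under sign changes, in a form that passes to sections. *)
Definition abs_invariant (R : realType) n (A : set 'rV[R]_n) :=
  forall x y : 'rV[R]_n, (forall i, `|x 0 i| = `|y 0 i|) -> A x -> A y.

(** By induction: the volume of the section at s is even in s, and each section is again
    [abs_invariant]. *)
Lemma vol_orthant (R : realType) n (A : set 'rV[R]_n) :
  borel A -> abs_invariant A ->
  (vol A = (2 ^+ n)%:E * vol (A `&` orthant))%E.
Proof.
elim: n A => [|n IHn] A mA iA.
  rewrite expr0 mul1e; congr vol; apply/seteqP; split => x /=; last by case.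
  by split => // -[].
have mAo : borel (A `&` orthant) by apply: measurableI => //; exact: borel_orthant.
have iAs s : abs_invariant (sect A s).
  move=> x y xy; apply: iA => i; rewrite !mxE.
  by case: unliftP => [j|].
rewrite (vol_sect mA) (vol_sect mAo) integral_even//; last 2 first.
- exact: measurable_vol_sect.
- move=> s; congr vol; apply/seteqP; split => v; apply: iA => i; rewrite !mxE;
  by case: unliftP => [j|] //=; rewrite normrN.
have sE s : 0 <= s -> sect (A `&` orthant) s = sect A s `&` orthant.
  move=> s0; apply/seteqP; split => v; rewrite /sect/= => -[Av vo]; split => // i.
    by have := vo (lift ord0 i); rewrite consRV_lift.
  by rewrite mxE; case: unliftP => [j|].
have sE0 s : s < 0 -> sect (A `&` orthant) s = set0.
  move=> s0; rewrite -subset0 => v [_ /(_ ord0)].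
  by rewrite consRV0 leNgt s0.
have -> : (\int[lebesgue_measure]_s vol (sect (A `&` orthant) s) =
    \int[lebesgue_measure]_(s in `[0%R, +oo[) vol (sect (A `&` orthant) s))%E.
  rewrite [RHS]integral_mkcond; apply: eq_integral => s _.
  rewrite patchE mem_setE in_itv/= andbT; case: ifPn => // s0.
  by rewrite sE0 ?ltNge// /vol measure0.
rewrite exprS EFinM -muleA; congr (_ * _)%E; rewrite -ge0_integralZl//; last first.
  by apply: measurable_funTS; exact: measurable_vol_sect.
apply: eq_integral => s; rewrite inE/= in_itv/= andbT => s0.
by rewrite sE//; apply: IHn => //; exact: borel_sect.
Qed.

(** * The Brunn-Minkowski inequality for down-closed sets *)

Lemma le_vol (R : realType) n (A B : set 'rV[R]_n) :
  borel A -> borel B -> A `<=` B -> (vol A <= vol B)%E.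
Proof. by move=> mA mB AB; apply: le_measure; rewrite ?inE. Qed.

Definition coord_bounded (R : realType) n (A : set 'rV[R]_n) :=
  exists M : R, forall x, A x -> forall i, `|x 0 i| <= M.

Lemma vol_fin_num (R : realType) n (A : set 'rV[R]_n) :
  borel A -> coord_bounded A -> vol A \is a fin_num.
Proof.
move=> mA [M AM]; rewrite ge0_fin_numE ?measure_ge0//.
pose N := Num.max 0 M.
have N0 : 0 <= N by rewrite le_max lexx.
apply: (@le_lt_trans _ _ (vol [set x : 'rV[R]_n | forall i,
    (const_mx (- N) : 'rV[R]_n) 0 i <= x 0 i <= (const_mx N : 'rV[R]_n) 0 i])).
  apply: le_vol => //; first exact: measurable_box.
  move=> x Ax i /=; rewrite !mxE -ler_norml.
  by rewrite (le_trans (AM _ Ax i))// le_max lexx orbT.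
rewrite /vol lebesgue_rV_box ?ltry// => i; rewrite !mxE.
by rewrite (le_trans _ N0)// oppr_le0.
Qed.

(** * The one-dimensional Prekopa-Leindler inequality for decreasing functions *)

Section prekopa_leindler.
Context {R : realType}.
Notation mu := (@lebesgue_measure R).
Local Open Scope ereal_scope.

(** Both sides measure the region under the graph of [f], cut vertically and horizontally. The
    condition 0 <= l empties the negative levels, so the right-hand integral can run over the whole
    line. *)
Lemma layer_cake (f : measurableTypeR R -> R) :
  measurable_fun setT f -> (forall s, 0 <= f s)%R ->
  measurable_fun setT (fun l : measurableTypeR R => mu [set s | (0 <= l < f s)%R]) /\
  \int[mu]_s (f s)%:E = \int[mu]_l mu [set s | (0 <= l < f s)%R].
Proof.
move=> mf f0.
pose S : set (measurableTypeR R * measurableTypeR R) :=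
  [set p | (0 <= p.2 < f p.1)%R].
have mS : measurable S.
  have -> : S = (snd @^-1` `[0%R, +oo[%classic) `&`
      ((fun p => f p.1 - p.2)%R @^-1` `]0%R, +oo[%classic).
    apply/seteqP; split => -[s l] /=; rewrite !in_itv/= !andbT subr_gt0.
      by move=> /andP[].
    by move=> [? ?]; apply/andP; split.
  apply: measurableI; rewrite -[X in measurable X]setTI.
    by apply: measurable_snd => //; exact: measurable_itv.
  have m : measurable_fun setT
      (fun p : measurableTypeR R * measurableTypeR R => (f p.1 - p.2)%R).
    by apply: measurable_funB; [exact: measurableT_comp|exact: measurable_snd].
  by apply: m => //; exact: measurable_itv.
have yS l : ysection S l = [set s | (0 <= l < f s)%R].
  by apply/seteqP; split => s; rewrite /ysection /= inE.
have xS s : mu (xsection S s) = (f s)%:E.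
  have -> : xsection S s = `[0%R, f s[%classic.
    by apply/seteqP; split => l; rewrite /xsection /= inE /S /= in_itv.
  rewrite [LHS]lebesgue_measure_itv/= lte_fin; case: ltP => h; last first.
    by rewrite (@le_anti _ _ (f s) 0%R) ?h ?f0.
  by rewrite sube0.
have myS := measurable_fun_ysection mu mS.
split; first by apply: eq_measurable_fun myS => l _ /=; rewrite yS.
have := indic_fubini_tonelli mu mu mS.
rewrite indic_fubini_tonelli_FE// indic_fubini_tonelli_GE//= => E.
transitivity (\int[mu]_s mu (xsection S s)).
  by apply: eq_integral => s _; rewrite xS.
by rewrite E; apply: eq_integral => l _; rewrite yS.
Qed.

(** Up to their right endpoints, [S] and [T] are intervals from 0 to their suprema a and b, so [U]
    contains [0, (a + b) / 2[. *)
Lemma interval_midpoint (S T U : set (measurableTypeR R)) (M : R) :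
  measurable S -> measurable T -> measurable U ->
  (forall s, S s -> (0 <= s <= M)%R) -> (forall s, T s -> (0 <= s <= M)%R) ->
  (forall s s', (0 <= s <= s')%R -> S s' -> S s) ->
  (forall s s', (0 <= s <= s')%R -> T s' -> T s) ->
  S 0%R -> T 0%R -> (forall s t, S s -> T t -> U ((s + t) / 2)%R) ->
  mu S + mu T <= 2%:E * mu U.
Proof.
move=> mS mT mU S0M T0M dS dT S0 T0 STU.
have key (V : set (measurableTypeR R)) : measurable V ->
    (forall s, V s -> (0 <= s <= M)%R) ->
    (forall s s', (0 <= s <= s')%R -> V s' -> V s) -> V 0%R ->
    exists a, [/\ (0 <= a)%R, mu V <= a%:E & forall s, (0 <= s)%R -> (s < a)%R -> V s].
  move=> mV V0M dV V0.
  have hV : has_sup V.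
    by split; [exists 0%R|exists M => s /V0M/andP[]].
  exists (sup V); split.
  - exact: (sup_upper_bound hV).
  - apply: (@le_trans _ _ (mu (`[0%R, sup V] : set (measurableTypeR R)))).
      apply: le_measure; rewrite ?inE//.
      move=> s Vs /=; rewrite in_itv/=; have /andP[-> _] := V0M s Vs.
      exact: (sup_upper_bound hV).
    rewrite lebesgue_measure_itv/= lte_fin; case: ifPn => // _.
      by rewrite sube0.
    by rewrite lee_fin; exact: (sup_upper_bound hV).
  - move=> s s0 /(sup_gt hV.1)[s' Vs' ss'].
    by apply: (dV _ s') => //; rewrite s0 ltW.
have [a [a0 Sa aS]] := key S mS S0M dS S0.
have [b [b0 Tb bT]] := key T mT T0M dT T0.
apply: (@le_trans _ _ (a + b)%:E); first by rewrite EFinD leeD.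
have [ab0|ab0] := leP (a + b)%R 0%R.
  by rewrite (@le_trans _ _ 0)// mule_ge0.
have -> : (a + b)%:E = 2%:E * mu (`[0%R, ((a + b) / 2)%R[ : set (measurableTypeR R)).
  rewrite lebesgue_measure_itv/= lte_fin divr_gt0// sube0 -EFinM.
  by congr (_%:E); field.
apply: lee_wpmul2l => //; apply: le_measure; rewrite ?inE//.
move=> u /=; rewrite in_itv/= => /andP[u0 ult].
(* A point u < (a + b) / 2 is the midpoint of 2 u a / (a + b) and 2 u b / (a + b), which lie below a
   and b, or are 0 when a or b is 0. *)
have hx (c : R) (V : set (measurableTypeR R)) : (0 <= c)%R -> V 0%R ->
    (forall s, (0 <= s)%R -> (s < c)%R -> V s) -> V (2 * u * c / (a + b))%R.
  rewrite le_eqVlt => /predU1P[<-|c0] V0 cV; first by rewrite mulr0 mul0r.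
  apply: cV; first by rewrite divr_ge0 ?mulr_ge0// ltW.
  by rewrite ltr_pdivrMr// mulrC ltr_pM2l//; lra.
have -> : (u = (2 * u * a / (a + b) + 2 * u * b / (a + b)) / 2)%R.
  by field; apply: lt0r_neq0.
by apply: STU; exact: hx.
Qed.

(** Dividing by the maxima f(0) and g(0) makes the superlevel sets nonempty for the same levels 0 <=
    l < 1. At each such level [interval_midpoint] applies, [layer_cake] integrates the result to an
    additive inequality, and the arithmetic-geometric mean inequality makes it multiplicative. *)
Lemma prekopa_leindler (f g h : measurableTypeR R -> R) (M : R) :
  measurable_fun setT f -> measurable_fun setT g -> measurable_fun setT h ->
  (forall s, 0 <= f s)%R -> (forall s, 0 <= g s)%R -> (forall s, 0 <= h s)%R ->
  (forall s, 0 < f s -> 0 <= s <= M)%R -> (forall s, 0 < g s -> 0 <= s <= M)%R ->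
  (forall s s', 0 <= s <= s' -> f s' <= f s)%R ->
  (forall s s', 0 <= s <= s' -> g s' <= g s)%R ->
  (forall s t, f s * g t <= h ((s + t) / 2) ^+ 2)%R ->
  (\int[mu]_s (f s)%:E) * (\int[mu]_s (g s)%:E) <= (\int[mu]_s (h s)%:E) ^+ 2.
Proof.
move=> mf mg mh f0 g0 h0 fM gM df dg fgh.
have I0 (u : measurableTypeR R -> R) : (forall s, 0 <= u s)%R ->
    0 <= \int[mu]_s (u s)%:E.
  by move=> u0; apply: integral_ge0 => s _; rewrite lee_fin.
(* A function whose maximum u(0) vanishes is zero everywhere; this settles the cases that cannot be
   normalised. *)
have top (u : measurableTypeR R -> R) : (forall s, 0 <= u s)%R ->
    (forall s, 0 < u s -> 0 <= s <= M)%R ->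
    (forall s s', 0 <= s <= s' -> u s' <= u s)%R ->
    u 0%R = 0%R -> \int[mu]_s (u s)%:E = 0.
  move=> u0 uM du uz; rewrite integral0_eq// => s _.
  have [us|us] := ltP 0%R (u s); last by congr EFin; apply/le_anti/andP; split.
  have /andP[s0 _] := uM s us.
  by have := du 0%R s; rewrite lexx s0 uz leNgt us => /(_ isT).
have [fz|fz] := eqVneq (f 0%R) 0%R.
  by rewrite (top f)// mul0e expe2 mule_ge0 ?I0.
have [gz|gz] := eqVneq (g 0%R) 0%R.
  by rewrite (top g)// mule0 expe2 mule_ge0 ?I0.
have fp : (0 < f 0)%R by rewrite lt_neqAle eq_sym fz f0.
have gp : (0 < g 0)%R by rewrite lt_neqAle eq_sym gz g0.
set a := f 0%R in fz fp; set b := g 0%R in gz gp.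
(* This scale for [h] preserves the midpoint hypothesis: (f / a) (g / b) <= (h / c)^2 at
   corresponding points. *)
pose c := Num.sqrt (a * b).
have cp : (0 < c)%R by rewrite sqrtr_gt0 mulr_gt0.
have c2 : (c ^+ 2 = a * b)%R by rewrite sqr_sqrtr// mulr_ge0// ltW.
have scale (u : measurableTypeR R -> R) (k : R) : (0 < k)%R ->
    measurable_fun setT u -> (forall s, 0 <= u s)%R ->
    measurable_fun setT (fun l : measurableTypeR R => mu [set s | (0 <= l < u s / k)%R]) /\
    k^-1%:E * \int[mu]_s (u s)%:E = \int[mu]_l mu [set s | (0 <= l < u s / k)%R].
  move=> k0 mu' u0.
  have [||m <-] := @layer_cake (fun s => u s / k)%R.
  - exact: measurable_funM.
  - by move=> s; rewrite divr_ge0// ltW.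
  split => //; rewrite -ge0_integralZl//.
  - by apply: eq_integral => s _; rewrite -EFinM mulrC.
  - exact/measurable_EFinP.
  - by move=> s _; rewrite lee_fin.
  - by rewrite lee_fin invr_ge0 ltW.
have [mlf Ef] := scale f a fp mf f0.
have [mlg Eg] := scale g b gp mg g0.
have [mlh Eh] := scale h c cp mh h0.
have mset (u : measurableTypeR R -> R) (k l : R) : measurable_fun setT u ->
    measurable ([set s | (0 <= l < u s / k)%R] : set (measurableTypeR R)).
  move=> mu'; have [l0|l0] : (0 <= l)%R \/ (l < 0)%R;
      [by case: (leP 0%R l); [left|right]| |]; last first.
    rewrite (_ : [set s | _] = set0)//; rewrite -subset0 => s /=.
    by move=> /andP[]; rewrite leNgt l0.
  have -> : [set s | (0 <= l < u s / k)%R] = (fun s => u s / k)%R @^-1` `]l, +oo[%classic.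
    by apply/seteqP; split => s /=; rewrite in_itv/= andbT l0.
  have m : measurable_fun setT (fun s => u s / k)%R by exact: measurable_funM.
  by rewrite -[X in measurable X]setTI; apply: m => //; exact: measurable_itv.
have key : a^-1%:E * \int[mu]_s (f s)%:E + b^-1%:E * \int[mu]_s (g s)%:E <=
    2%:E * (c^-1%:E * \int[mu]_s (h s)%:E).
  rewrite Ef Eg Eh -ge0_integralD// -ge0_integralZl//.
  apply: ge0_le_integral => //.
  - by move=> l _; rewrite adde_ge0.
  - exact: emeasurable_funD.
  - exact: measurable_funeM.
  move=> l _; have [l1|l1] := leP 1%R l.
    have z (u : measurableTypeR R -> R) (k : R) : (0 < k)%R ->
        (forall s, 0 < u s -> 0 <= s <= M)%R ->
        (forall s s', 0 <= s <= s' -> u s' <= u s)%R -> k = u 0%R ->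
        [set s | (0 <= l < u s / k)%R] = set0.
      move=> k0 uM du ku; rewrite -subset0 => s /= /andP[l0].
      rewrite ltr_pdivlMr// => lu.
      have us : (0 < u s)%R by rewrite (le_lt_trans _ lu)// mulr_ge0// ltW.
      have /andP[s0 _] := uM s us.
      have : (u s <= k)%R by rewrite ku; apply: du; rewrite lexx.
      by rewrite leNgt (le_lt_trans _ lu)// ler_peMl// ltW.
    by rewrite (z f a)// (z g b)// measure0 adde0 mule_ge0.
  have [l0|l0] : (0 <= l)%R \/ (l < 0)%R;
      [by case: (leP 0%R l); [left|right]| |]; last first.
    have z (u : measurableTypeR R -> R) (k : R) : [set s | (0 <= l < u s / k)%R] = set0.
      by rewrite -subset0 => s /= /andP[]; rewrite leNgt l0.
    by rewrite !z measure0 adde0 mule0.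
  have lev (u : measurableTypeR R -> R) (k s : R) : (0 < k)%R ->
      (0 <= l < u s / k)%R -> (0 < u s)%R.
    move=> k0 /andP[_]; rewrite ltr_pdivlMr//; apply: le_lt_trans.
    by rewrite mulr_ge0// ltW.
  apply: (@interval_midpoint _ _ _ M); try exact: mset.
  - by move=> s /= /(lev _ _ _ fp); exact: fM.
  - by move=> s /= /(lev _ _ _ gp); exact: gM.
  - move=> s s' ss' /= /andP[-> /lt_le_trans]; apply.
    by rewrite ler_pM2r ?invr_gt0//; exact: df.
  - move=> s s' ss' /= /andP[-> /lt_le_trans]; apply.
    by rewrite ler_pM2r ?invr_gt0//; exact: dg.
  - by rewrite /= l0 -/a divff.
  - by rewrite /= l0 -/b divff.
  move=> s t /= /andP[_ ls] /andP[_ lt]; rewrite l0/=.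
  rewrite ltr_pdivlMr// -(@ltr_pXn2r _ 2)// ?nnegrE ?mulr_ge0 ?(ltW cp)//.
  apply: lt_le_trans (fgh s t); rewrite exprMn c2 expr2 mulrACA.
  by move: ls lt; rewrite !ltr_pdivlMr// => ls lt;
    apply: ltr_pM => //; rewrite mulr_ge0// ltW.
move: key (I0 _ f0) (I0 _ g0) (I0 _ h0).
move: (\int[mu]_s (f s)%:E) (\int[mu]_s (g s)%:E) (\int[mu]_s (h s)%:E).
move=> F G [H| |]//; last first.
  by move=> _ _ _ _; rewrite expe2 mulyy leey.
case: F => [F| |]; case: G => [G| |]//=.
(* For the normalised integrals, x + y <= 2 z gives x y <= ((x + y) / 2)^2 <= z^2. In the other
   cases an infinite integral of [f] or [g] contradicts [key]. *)
- rewrite !lee_fin -expr2 => key F0 G0 H0.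
  have ab : (0 < a * b)%R by exact: mulr_gt0.
  rewrite -(@ler_pM2l _ (a * b)^-1) ?invr_gt0//.
  have -> : ((a * b)^-1 * H ^+ 2 = (c^-1 * H) ^+ 2)%R by rewrite exprMn exprVn c2.
  have -> : ((a * b)^-1 * (F * G) = (a^-1 * F) * (b^-1 * G))%R.
    by rewrite invfM mulrACA.
  have : (0 <= a^-1 * F)%R by rewrite mulr_ge0// invr_ge0 ltW.
  have : (0 <= b^-1 * G)%R by rewrite mulr_ge0// invr_ge0 ltW.
  move: key; move: (a^-1 * F)%R (b^-1 * G)%R (c^-1 * H)%R => x y z k y0 x0.
  apply: (@le_trans _ _ (((x + y) / 2) ^+ 2)%R).
    by rewrite -subr_ge0 (_ : (_ - _ = ((x - y) / 2) ^+ 2)%R) ?sqr_ge0//; field.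
  by rewrite ler_pXn2r ?nnegrE//; lra.
- by rewrite gt0_muley ?lte_fin ?invr_gt0// -!EFinM addey.
- by rewrite gt0_muley ?lte_fin ?invr_gt0// -!EFinM addye.
- by rewrite !gt0_muley ?lte_fin ?invr_gt0// -!EFinM.
Qed.

End prekopa_leindler.

Definition down_closed (R : realType) n (A : set 'rV[R]_n) :=
  A `<=` orthant /\
  forall x y : 'rV[R]_n, (forall i, 0 <= x 0 i <= y 0 i) -> A y -> A x.

Lemma down_closed_sect (R : realType) n (A : set 'rV[R]_n.+1) s :
  down_closed A -> down_closed (sect A s).
Proof.
move=> [Ao dA]; split=> [v /Ao vo i|v w vw Aw].
  by have := vo (lift ord0 i); rewrite consRV_lift.
have s0 : 0 <= s by have := Ao _ Aw ord0; rewrite consRV0.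
by apply: dA Aw => i; rewrite !mxE; case: unliftP => [j|] _ //; rewrite s0 lexx.
Qed.

Lemma coord_bounded_sect (R : realType) n (A : set 'rV[R]_n.+1) s :
  coord_bounded A -> coord_bounded (sect A s).
Proof.
move=> [M AM]; exists M => v Av i.
by have := AM _ Av (lift ord0 i); rewrite consRV_lift.
Qed.

(** Induction on the dimension: the induction hypothesis for the sections at s, t and (s + t) / 2 is
    the midpoint hypothesis of [prekopa_leindler] for the section volumes, and those of [A] and [B]
    decrease because these sets are down-closed. *)
Lemma brunn_minkowski (R : realType) n (A B C : set 'rV[R]_n) :
  borel A -> borel B -> borel C ->
  coord_bounded A -> coord_bounded B -> coord_bounded C ->
  down_closed A -> down_closed B ->
  (forall x y, A x -> B y -> C (2^-1 *: (x + y))) ->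
  (vol A * vol B <= vol C ^+ 2)%E.
Proof.
elim: n A B C => [|n IHn] A B C mA mB mC bA bB bC dA dB ABC.
  have C0 x y : A x -> B y -> C 0.
    move=> Ax By; have := ABC _ _ Ax By.
    by rewrite (_ : _ *: _ = 0)//; apply/rowP => -[].
  have dir (D : set 'rV[R]_0) : vol D = (0 \in D)%:R%:E by rewrite /vol /= diracE.
  rewrite !dir; have [/set_mem A0|_] := boolP (0 \in A); last first.
    by rewrite mul0e expe2 mule_ge0.
  have [/set_mem B0|_] := boolP (0 \in B); last by rewrite mule0 expe2 mule_ge0.
  by rewrite mem_set ?expe2 ?mule1//; exact: C0 A0 B0.
have fin (D : set 'rV[R]_n.+1) s : borel D -> coord_bounded D ->
    vol (sect D s) = (fine (vol (sect D s)))%:E.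
  move=> mD bD; rewrite fineK// vol_fin_num//; first exact: borel_sect.
  exact: coord_bounded_sect.
have mfin (D : set 'rV[R]_n.+1) : borel D ->
    measurable_fun [set: measurableTypeR R] (fun s : measurableTypeR R => fine (vol (sect D s))).
  by move=> mD; apply: measurableT_comp => //; exact: measurable_vol_sect.
have volE (D : set 'rV[R]_n.+1) : borel D -> coord_bounded D ->
    (vol D = \int[lebesgue_measure]_s (fine (vol (sect D s)))%:E)%E.
  by move=> mD bD; rewrite (vol_sect mD); apply: eq_integral => s _; rewrite fin.
rewrite (volE A)// (volE B)// (volE C)//.
have [MA AM] := bA; have [MB BM] := bB.
have ge0 (D : set 'rV[R]_n.+1) s : 0 <= fine (vol (sect D s)).
  by rewrite fine_ge0// measure_ge0.
have supp (D : set 'rV[R]_n.+1) M s : down_closed D -> (forall x, D x -> forall i, `|x 0 i| <= M) ->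
    0 < fine (vol (sect D s)) -> 0 <= s <= M.
  move=> [Do _] DM; have [->|] := eqVneq (sect D s) set0.
    by rewrite /vol measure0 ltxx.
  move=> /set0P[v Dv] _; have := Do _ Dv ord0; have := DM _ Dv ord0.
  by rewrite consRV0 => + s0; rewrite ger0_norm// s0.
have anti (D : set 'rV[R]_n.+1) s s' : borel D -> coord_bounded D -> down_closed D ->
    0 <= s <= s' -> fine (vol (sect D s')) <= fine (vol (sect D s)).
  move=> mD bD [Do dD] ss'; rewrite -lee_fin -!fin//.
  apply: le_vol; try exact: borel_sect.
  move=> v Dv; apply: (dD _ _ _ Dv) => i; have := Do _ Dv i; rewrite !mxE.
  by case: unliftP => [j|] _ // ->; rewrite lexx.
apply: (@prekopa_leindler _ _ _ _ (Num.max MA MB)) => //; try exact: mfin.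
- move=> s /(supp _ _ _ dA AM)/andP[-> /le_trans]; apply.
  by rewrite le_max lexx.
- move=> s /(supp _ _ _ dB BM)/andP[-> /le_trans]; apply.
  by rewrite le_max lexx orbT.
- by move=> s s'; exact: anti.
- by move=> s s'; exact: anti.
move=> s t; rewrite -lee_fin EFinM EFin_expe -!fin//.
apply: IHn; try exact: borel_sect; try exact: coord_bounded_sect;
  try exact: down_closed_sect.
move=> v w Av Bw; have := ABC _ _ Av Bw; rewrite /sect /=; congr C.
by apply/rowP => i; rewrite !mxE /=; case: unliftP => [j|] _;
  rewrite ?mxE// mulrC.
Qed.

(** * Marginals of unconditional convex bodies *)

Lemma measurable_coord (R : realType) n (i : 'I_n) :
  measurable_fun [set: borelRV R n] (fun x : borelRV R n => (x : 'rV[R]_n) 0 i).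
Proof.
apply: (measurability _ (measurable_realfun.RGenOpens.measurableE R)).
move=> _ [_ [a [b ->]] <-]; rewrite setTI.
apply: open_measurable_rV; have /continuousP := @coord_continuous R 1 n 0 i.
by apply; exact: interval_open.
Qed.

Lemma coord_le_norm (R : realType) n (x : 'rV[R]_n) i : `|x 0 i| <= `|x|.
Proof.
have /mapP[j _ ->] : `|x 0 i| \in [seq `|x k.1 k.2| | k : 'I_1 * 'I_n].
  by apply/mapP; exists (0, i) => //=; rewrite mem_enum.
by rewrite [leRHS]/Num.norm /= mx_normrE; apply/bigmax_geP; right => /=; exists j.
Qed.

(** [fine] sends an infinite volume to 0, so comparisons of real volumes come with a boundedness
    hypothesis. *)
Definition rvol (R : realType) n (A : set 'rV[R]_n) : R := fine (vol A).

Lemma coord_boundedS (R : realType) n (A B : set 'rV[R]_n) :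
  A `<=` B -> coord_bounded B -> coord_bounded A.
Proof. by move=> AB [M BM]; exists M => x /AB/BM. Qed.

Lemma rvolK (R : realType) n (A : set 'rV[R]_n) :
  borel A -> coord_bounded A -> ((rvol A)%:E = vol A)%E.
Proof. by move=> mA bA; rewrite /rvol fineK// vol_fin_num. Qed.

Lemma rvol_ge0 (R : realType) n (A : set 'rV[R]_n) : 0 <= rvol A.
Proof. by rewrite /rvol fine_ge0// measure_ge0. Qed.

Lemma le_rvol (R : realType) n (A B : set 'rV[R]_n) :
  borel A -> borel B -> coord_bounded B -> A `<=` B -> rvol A <= rvol B.
Proof.
move=> mA mB bB AB; rewrite -lee_fin !rvolK//; first exact: le_vol.
exact: coord_boundedS bB.
Qed.

Lemma rvol_affine (R : realType) n (c b : 'rV[R]_n) (A : set 'rV[R]_n) :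
  (forall i, 0 < c 0 i) -> borel A ->
  rvol (affine_rV c b @^-1` A) = (\prod_i c 0 i)^-1 * rvol A.
Proof.
move=> c0 mA; rewrite /rvol vol_affine//.
have p0 : 0 < (\prod_i c 0 i)^-1 by rewrite invr_gt0 prodr_gt0.
case: (vol A) => [r //| |].
- by rewrite gt0_muley ?lte_fin//= mulr0.
- by rewrite gt0_muleNy ?lte_fin//= mulr0.
Qed.

Lemma rvol_orthant (R : realType) n (A : set 'rV[R]_n) :
  borel A -> abs_invariant A -> coord_bounded A ->
  rvol A = 2 ^+ n * rvol (A `&` orthant).
Proof.
move=> mA iA bA; apply/EFin_inj; rewrite EFinM !rvolK//; first exact: vol_orthant.
- by apply: measurableI => //; exact: borel_orthant.
- by apply: coord_boundedS bA => x [].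
Qed.

Lemma rvol_box_gt0 (R : realType) n (A : set 'rV[R]_n) (a b : 'rV[R]_n) :
  borel A -> coord_bounded A -> (forall i, a 0 i < b 0 i) ->
  (forall x : 'rV[R]_n, (forall i, a 0 i <= x 0 i <= b 0 i) -> A x) -> 0 < rvol A.
Proof.
move=> mA bA ab Aab; rewrite -lte_fin rvolK//.
apply: (@lt_le_trans _ _ (vol [set x : 'rV[R]_n | forall i, a 0 i <= x 0 i <= b 0 i])).
  rewrite /vol lebesgue_rV_box => [|i]; last exact: ltW.
  by rewrite lte_fin prodr_gt0// => i _; rewrite subr_gt0.
by apply: le_vol => //; exact: measurable_box.
Qed.

Lemma rvolDI (R : realType) n (A B : set 'rV[R]_n) :
  borel A -> borel B -> coord_bounded A ->
  rvol A = rvol (A `\` B) + rvol (A `&` B).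
Proof.
move=> mA mB bA; apply/EFin_inj; rewrite EFinD !rvolK//.
- exact: (@measureDI _ _ _ (lebesgue_rV n)).
- exact: measurableI.
- by apply: coord_boundedS bA => x [].
- exact: measurableD.
- by apply: coord_boundedS bA => x [].
Qed.

(** Removing the last set from the others costs at most [p] for each of them, and induction handles
    what remains in [B]; m^2 generously counts the pairs. With p = 0 it packs disjoint sets into
    [B]. *)
Lemma rvol_bonferroni (R : realType) n m (A : 'I_m -> set 'rV[R]_n)
    (B : set 'rV[R]_n) (p : R) :
  (forall k, borel (A k)) -> borel B -> coord_bounded B ->
  (forall k, A k `<=` B) -> 0 <= p ->
  (forall j k, j != k -> rvol (A j `&` A k) <= p) ->
  \sum_k rvol (A k) <= rvol B + m%:R ^+ 2 * p.
Proof.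
elim: m A B => [|m IHm] A B mA mB bB AB p0 Ap.
  by rewrite big_ord0 addr_ge0 ?rvol_ge0// mulr_ge0// sqr_ge0.
have bA k : coord_bounded (A k) by exact: coord_boundedS bB.
rewrite big_ord_recr/=; set Am := A ord_max.
pose A' k := A (widen_ord (leqnSn m) k) `\` Am.
have le1 : \sum_(k < m) rvol (A (widen_ord (leqnSn m) k)) <=
    \sum_(k < m) rvol (A' k) + m%:R * p.
  rewrite mulr_natl -[m in _ *+ m]card_ord -sumr_const -big_split/=.
  apply: ler_sum => k _; rewrite (rvolDI _ (mA ord_max))// lerD2l Ap//.
  by rewrite -val_eqE/= ltn_eqF.
have le2 : \sum_(k < m) rvol (A' k) <= rvol (B `\` Am) + m%:R ^+ 2 * p.
  apply: IHm => //.
  - by move=> k; apply: measurableD; exact: mA.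
  - by apply: measurableD => //; exact: mA.
  - by apply: coord_boundedS bB => x [].
  - by move=> k x [/AB Bx Amx].
  - move=> j k jk; apply: (@le_trans _ _ (rvol (A (widen_ord (leqnSn m) j) `&`
        A (widen_ord (leqnSn m) k)))); last first.
      by apply: Ap; move: jk; rewrite -!val_eqE.
    apply: le_rvol.
    + by apply: measurableI; apply: measurableD; exact: mA.
    + by apply: measurableI; exact: mA.
    + by apply: coord_boundedS (bA (widen_ord (leqnSn m) j)) => x [].
    + by move=> x [[? _] [? _]].
have BE : rvol B = rvol (B `\` Am) + rvol Am.
  by rewrite (rvolDI mB (mA ord_max))// (setIidr (AB _)).
rewrite BE -natr1.
have mp : 0 <= m%:R * p :> R by rewrite mulr_ge0.
move: le1 le2 mp p0; set s := \sum_k _; set s' := \sum_k _.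
set u := rvol _; set v := rvol Am; set k := (m%:R : R).
have -> : (k + 1) ^+ 2 * p = k ^+ 2 * p + 2 * (k * p) + p by ring.
by set kp := k * p; set kkp := k ^+ 2 * p; lra.
Qed.

Lemma bernoulli_expr (R : realType) (e : R) n : 0 <= e <= 1 ->
  1 - n%:R * e <= (1 - e) ^+ n.
Proof.
move=> /andP[e0 e1]; elim: n => [|n IHn]; first by rewrite mul0r subr0 expr0.
rewrite exprS; apply: (@le_trans _ _ ((1 - e) * (1 - n%:R * e))); last first.
  by rewrite ler_wpM2l// subr_ge0.
rewrite -[n.+1]addn1 natrD; have : 0 <= n%:R * e ^+ 2 by rewrite mulr_ge0 ?sqr_ge0.
by set k : R := n%:R; rewrite expr2 mulrBl mulrBr; nra.
Qed.

(** * Solidity of unconditional convex bodies *)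

Section body.
Context {R : realType} {n : nat} (Q : set 'rV[R]_n).
Hypotheses (cQ : convex_body Q) (uQ : unconditional Q).

Lemma body_closed : closed Q.
Proof.
by have [kQ _ _] := cQ; apply: compact_closed kQ; exact: norm_hausdorff.
Qed.

Lemma body_borel : borel Q.
Proof. by apply: borel_closed; exact: body_closed. Qed.

Lemma body_bounded : coord_bounded Q.
Proof.
have [/compact_bounded[M [_ QM]] _ _] := cQ.
exists (M + 1) => x Qx i; apply: le_trans (coord_le_norm x i) _.
by apply: QM => //; rewrite ltrDl.
Qed.

Lemma body_abs : abs_invariant Q.
Proof.
move=> x y xy Qx; rewrite -(uQ [ffun i => x 0 i != y 0 i]); exists x => //.
apply/rowP => i; rewrite mxE ffunE.
have [->|nxy] := eqVneq (x 0 i) (y 0 i); first by rewrite expr0 mul1r.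
rewrite expr1 mulN1r; have := eqP (introT eqP (xy i)).
by move/eqP; rewrite eqr_norm2 (negbTE nxy)/= => /eqP ->; rewrite opprK.
Qed.

Lemma body_conv (x y : 'rV[R]_n) (t : R) : Q x -> Q y -> 0 <= t <= 1 ->
  Q (t *: x + (1 - t) *: y).
Proof.
move=> Qx Qy /andP[t0 t1]; have [_ convQ _] := cQ.
have := convQ x y (Itv01 t0 t1) (mem_set Qx) (mem_set Qy).
by rewrite inE.
Qed.

(** Coordinates are replaced one at a time: since |x_i| <= |y_i|, the new point lies on the segment
    between the current one and its reflection in that coordinate. *)
Lemma body_solid (x y : 'rV[R]_n) :
  (forall i, `|x 0 i| <= `|y 0 i|) -> Q y -> Q x.
Proof.
move=> xy Qy.
pose z k : 'rV[R]_n := \row_i (if (i < k)%N then x 0 i else y 0 i).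
suff zQ k : Q (z k).
  by rewrite (_ : x = z n)//; apply/rowP => i; rewrite mxE ltn_ord.
elim: k => [|k IHk]; first by rewrite (_ : z 0%N = y)//; apply/rowP => i; rewrite mxE.
have [nk|kn] := leqP n k.
  rewrite (_ : z k.+1 = z k)//; apply/rowP => i; rewrite !mxE.
  by rewrite ltnS !(leq_trans (ltn_ord i))// ltnW// (leq_trans (ltn_ord i)).
pose o := Ordinal kn.
pose w : 'rV[R]_n := \row_i (if i == o then - z k 0 i else z k 0 i).
have Qw : Q w.
  apply: (body_abs _ IHk) => i; rewrite [in RHS]mxE.
  by case: ifP => _ //; rewrite normrN.
have [y0|y0] := eqVneq (y 0 o) 0.
  rewrite (_ : z k.+1 = z k)//; apply/rowP => i; rewrite !mxE ltnS leq_eqVlt.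
  have [ik|//] := eqVneq (i : nat) k.
  have -> : i = o by exact: val_inj.
  rewrite ltnn/= y0; apply/eqP; rewrite -normr_le0.
  by rewrite (le_trans (xy o))// y0 normr0.
(* The solution of t y_o - (1 - t) y_o = x_o. *)
pose t := (x 0 o / y 0 o + 1) / 2.
have t01 : 0 <= t <= 1.
  have : `|x 0 o / y 0 o| <= 1.
    by rewrite normrM normfV ler_pdivrMr ?normr_gt0// mul1r.
  by rewrite ler_norml /t; lra.
rewrite (_ : z k.+1 = t *: z k + (1 - t) *: w); first exact: body_conv.
apply/rowP => i; rewrite !mxE ltnS leq_eqVlt -val_eqE /=.
have [ik|_] := eqVneq (i : nat) k; last first.
  by case: ifP => _; ring.
have -> : i = o by exact: val_inj.
by rewrite ltnn /t; field.
Qed.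

(** An interior point pushed away from the origin by e / 2 in every coordinate stays in [Q] and
    dominates the cube of half-side e / 2 coordinatewise. *)
Lemma body_cube : exists2 d : R, 0 < d &
  forall x : 'rV[R]_n, (forall i, `|x 0 i| <= d) -> Q x.
Proof.
have [_ _ [x0 /nbhs_ballP[e /= e0 eQ]]] := cQ.
exists (e / 2) => [|x xe]; first exact: divr_gt0.
(* Since the sign of 0 is 0, the last summand is there to move the vanishing coordinates. *)
pose y : 'rV[R]_n := \row_i (x0 0 i + Num.sg (x0 0 i) * (e / 2) + (x0 0 i == 0)%:R * (e / 2)).
apply: (@body_solid _ y) => [i|].
  apply: le_trans (xe i) _; rewrite mxE.
  have [->|x00] := eqVneq (x0 0 i) 0.
    by rewrite sgr0 mul0r !add0r mul1r ger0_norm// divr_ge0// ltW.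
  rewrite mul0r addr0 {1}[x0 0 i]numEsg -mulrDr normrM.
  have e20 : 0 <= e / 2 by rewrite divr_ge0// ltW.
  by rewrite normr_sg x00 mul1r ger0_norm ?lerDr// addr_ge0.
apply: eQ; split => // i j; rewrite !mxE (ord1 i) /ball/= -addrA opprD addNKr normrN.
have [->|x00] := eqVneq (x0 0 j) 0.
  by rewrite sgr0 mul0r add0r mul1r ger0_norm ?divr_ge0 ?(ltW e0)//; lra.
rewrite mul0r addr0 normrM normr_sg x00 mul1r ger0_norm ?divr_ge0 ?(ltW e0)//; lra.
Qed.

(** * Decay of the coordinate tails *)

Definition body_tail (i : 'I_n) (t : R) : set 'rV[R]_n :=
  Q `&` [set x | t <= `|x 0 i|].

Lemma body_tail_borel i t : borel (body_tail i t).
Proof.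
apply: measurableI; first exact: body_borel.
apply: borel_closed.
apply: (@preimage_closed _ _ (fun x : 'rV[R]_n => `|x 0 i|) [set y | t <= y]).
  move=> x _; apply: continuous_comp; first exact: coord_continuous.
  exact: norm_continuous.
exact: closed_ge.
Qed.

Lemma body_tail_bounded i t : coord_bounded (body_tail i t).
Proof. by apply: coord_boundedS body_bounded => x []. Qed.

Lemma rvol_body_gt0 : 0 < rvol Q.
Proof.
have [d d0 dQ] := body_cube.
apply: (@rvol_box_gt0 _ _ _ (const_mx 0) (const_mx d)).
- exact: body_borel.
- exact: body_bounded.
- by move=> i; rewrite !mxE.
- move=> x x0; apply: dQ => i; have := x0 i; rewrite !mxE => /andP[? ?].
  by rewrite ger0_norm.
Qed.

Lemma rvol_body_tail_gt0 i : exists2 t, 0 < t & 0 < rvol (body_tail i t).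
Proof.
have [d d0 dQ] := body_cube; exists (d / 2); first exact: divr_gt0.
apply: (@rvol_box_gt0 _ _ _ (const_mx (d / 2)) (const_mx d)).
- exact: body_tail_borel.
- exact: body_tail_bounded.
- by move=> j; rewrite !mxE; lra.
- move=> x x0; have {}x0 j : d / 2 <= `|x 0 j| <= d.
    have := x0 j; rewrite !mxE => /andP[h1 h2].
    by rewrite ger0_norm ?h1// (le_trans _ h1)// divr_ge0// ltW.
  split; last by have /andP[] := x0 i.
  by apply: dQ => j; have /andP[] := x0 j.
Qed.

(* With Q+ = Q ∩ orthant, midpoints of Q+ and Q+ ∩ {x_i >= 2t} lie in
   Q+ ∩ {x_i >= t}; shifting the last two sets down to {x_i >= 0} makes them
   down-closed. *)
Lemma rvol_body_tail_double i t : 0 <= t ->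
  rvol Q * rvol (body_tail i (2 * t)) <= rvol (body_tail i t) ^+ 2.
Proof.
move=> t0.
have tail_abs s : abs_invariant (body_tail i s).
  move=> x y xy [Qx sx]; split; first exact: body_abs Qx.
  by rewrite /= -xy.
have mQ := body_borel; have bQ := body_bounded.
rewrite (rvol_orthant mQ body_abs bQ).
rewrite (rvol_orthant (body_tail_borel i (2 * t)) (tail_abs _) (body_tail_bounded _ _)).
rewrite (rvol_orthant (body_tail_borel i t) (tail_abs _) (body_tail_bounded _ _)).
rewrite mulrACA exprMn -expr2 ler_pM2l ?exprn_gt0//.
pose e s : 'rV[R]_n := \row_j (if j == i then s else 0).
pose B s := affine_rV (const_mx 1) (e s) @^-1` (body_tail i s `&` orthant).
have mTo s : borel (body_tail i s `&` orthant).
  by apply: measurableI; [exact: body_tail_borel|exact: borel_orthant].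
have mB s : borel (B s) by apply: borel_preimage => //; exact: continuous_affine_rV.
have volB s : rvol (B s) = rvol (body_tail i s `&` orthant).
  rewrite rvol_affine//; last by move=> j; rewrite mxE.
  by rewrite big1 ?invr1 ?mul1r// => j _; rewrite mxE.
have affE s x : affine_rV (const_mx 1) (e s) x = x + e s.
  by apply/rowP => j; rewrite !mxE mul1r.
have BE s : 0 <= s -> B s = [set x | Q (x + e s) /\ orthant x].
  move=> s0; apply/seteqP; split => x; rewrite /B /= affE.
    move=> [[Qx /= sx] xo]; split => // j; have := xo j; rewrite !mxE.
    case: eqP => [->|_]; last by rewrite addr0.
    have := xo i; rewrite !mxE eqxx => xi0; move: sx; rewrite !mxE eqxx ger0_norm//.
    by rewrite lerDr.
  move=> [Qx xo]; split; last first.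
    move=> j; rewrite !mxE addr_ge0//; case: eqP => // _.
  by split => //=; rewrite !mxE eqxx ger0_norm ?lerDr ?xo// addr_ge0.
have B0 s : 0 <= s -> B s `<=` Q.
  move=> s0 x; rewrite BE// => -[Qx xo]; apply: body_solid Qx => j.
  have := xo j; rewrite !mxE; case: eqP => _ x0; last by rewrite addr0.
  by rewrite !ger0_norm ?lerDl// addr_ge0.
have bB s : 0 <= s -> coord_bounded (B s).
  by move=> s0; apply: coord_boundedS bQ; exact: B0.
have t20 : 0 <= 2 * t by rewrite mulr_ge0.
have mQo : borel (Q `&` orthant).
  by apply: measurableI => //; exact: borel_orthant.
have bQo : coord_bounded (Q `&` orthant) by apply: coord_boundedS bQ => x [].
rewrite -!volB -lee_fin EFinM EFin_expe !rvolK//; try exact: bB.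
apply: brunn_minkowski => //; try exact: bB.
- split => [x []//|x y xy [Qy yo]]; split; last by move=> j; have /andP[] := xy j.
  apply: body_solid Qy => j; have /andP[x0 xyj] := xy j.
  by rewrite !ger0_norm// (le_trans x0).
- rewrite BE//; split => [x []//|x y xy [Qy yo]].
  split; last by move=> j; have /andP[] := xy j.
  apply: body_solid Qy => j; have /andP[x0 xyj] := xy j; rewrite !mxE.
  have e0 : 0 <= (if j == i then 2 * t else 0) by case: ifP.
  by rewrite !ger0_norm ?lerD2r// addr_ge0// (le_trans x0).
- rewrite !BE// => x y [Qx xo] [Qy yo]; split.
    rewrite (_ : _ + _ = 2^-1 *: x + (1 - 2^-1) *: (y + e (2 * t))).
      by apply: body_conv => //; lra.
    by apply/rowP => j; rewrite !mxE; case: eqP => _; field.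
  by move=> j; rewrite !mxE mulr_ge0 ?invr_ge0// addr_ge0.
Qed.

(** * Second moments and the spread of a coordinate *)

Let moment2 i : \bar R :=
  (\int[lebesgue_rV n]_(x in Q) ((x : 'rV[R]_n) 0 i ^+ 2)%:E)%E.

Let measurable_sqr i : @measurable_fun _ _ (borelRV R n) _ Q
  (fun x : borelRV R n => ((x : 'rV[R]_n) 0 i ^+ 2)%:E).
Proof.
apply: measurable_funTS; apply/measurable_EFinP; apply: measurable_funX.
exact: measurable_coord.
Qed.

Let mQ : measurable (Q : set (borelRV R n)). Proof. exact: body_borel. Qed.

Let moment2_ge0 i : (0 <= moment2 i)%E.
Proof. by apply: integral_ge0 => x _; rewrite lee_fin sqr_ge0. Qed.

Let moment2_fin i : moment2 i \is a fin_num.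
Proof.
have [M QM] := body_bounded.
rewrite ge0_fin_numE//; apply: (@le_lt_trans _ _
  (\int[lebesgue_rV n]_(x in Q) (cst (M ^+ 2)%:E x))%E).
  apply: ge0_le_integral => //.
  - by move=> x _; rewrite lee_fin sqr_ge0.
  - by move=> x Qx; rewrite lee_fin -real_normK ?num_real// lerXn2r ?nnegrE ?QM//;
      rewrite (le_trans _ (QM _ Qx i)).
rewrite integral_cst// -[X in (_ * X)%E]/(vol Q).
by rewrite -(rvolK body_borel body_bounded) -EFinM ltry.
Qed.

Let sigma_sqr i : sigma Q i ^+ 2 * rvol Q = fine (moment2 i).
Proof.
have V0 := rvol_body_gt0.
rewrite /sigma sqr_sqrtr; last first.
  by apply: mulr_ge0; [rewrite invr_ge0; exact: ltW|exact/fine_ge0/moment2_ge0].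
by rewrite mulrAC mulVf ?mul1r//; exact: lt0r_neq0.
Qed.

Lemma body_chebyshev i t : 0 <= t ->
  t ^+ 2 * rvol (body_tail i t) <= sigma Q i ^+ 2 * rvol Q.
Proof.
move=> t0; rewrite sigma_sqr -lee_fin fineK//.
rewrite EFinM rvolK; [|exact: body_tail_borel|exact: body_tail_bounded].
have mT : measurable (body_tail i t : set (borelRV R n)) by exact: body_tail_borel.
rewrite /vol -integral_cst//.
apply: (@le_trans _ _ (\int[lebesgue_rV n]_(x in body_tail i t)
    ((x : 'rV[R]_n) 0 i ^+ 2)%:E)%E).
  apply: ge0_le_integral => //.
  - by move=> x _; rewrite lee_fin sqr_ge0.
  - by apply: measurable_funS (measurable_sqr i) => // x [].
  - move=> x [_ /= tx]; rewrite lee_fin -[leRHS]real_normK ?num_real//.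
    by rewrite lerXn2r ?nnegrE.
apply: ge0_subset_integral => //.
- by move=> x _; rewrite lee_fin sqr_ge0.
- by move=> x [].
Qed.

(** By [rvol_body_tail_double], doubling T at least squares the relative tail volume, which starts
    at 1/8 or less; so the tail at 2^k T has relative volume at most 8^-(k+1). On the shell between
    2^k T and 2^(k+1) T the square is at most 4^(k+1) T^2, and the sum of 4^(k+1) 8^-(k+1) stays
    below 1. The other T^2 accounts for |x_i| < T. *)
Lemma body_moment_le i T : 0 < T -> 8 * rvol (body_tail i T) <= rvol Q ->
  sigma Q i ^+ 2 <= 2 * T ^+ 2.
Proof.
move=> T0 hT; have V0 := rvol_body_gt0.
have tailX k : 8 ^+ k.+1 * rvol (body_tail i (2 ^+ k * T)) <= rvol Q.
  elim: k => [|k IHk]; first by rewrite expr1 expr0 mul1r.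
  have := @rvol_body_tail_double i (2 ^+ k * T).
  rewrite mulrA -exprS mulr_ge0 ?exprn_ge0 ?(ltW T0)// => /(_ isT).
  set p := rvol _ in IHk *; set q := rvol (body_tail _ _) => pq.
  have p0 : 0 <= p by exact: rvol_ge0.
  rewrite -(ler_pM2l V0) mulrCA (le_trans (ler_wpM2l _ pq)) ?exprn_ge0//.
  apply: (@le_trans _ _ (8 ^+ k.+1 * 8 ^+ k.+1 * p ^+ 2)).
    rewrite ler_wpM2r ?sqr_ge0// exprS ler_wpM2r ?exprn_ge0// exprS.
    by rewrite ler_peMr// exprn_ege1// ler1n.
  have -> : 8 ^+ k.+1 * 8 ^+ k.+1 * p ^+ 2 = (8 ^+ k.+1 * p) ^+ 2 by ring.
  rewrite -expr2 lerXn2r ?nnegrE ?mulr_ge0 ?exprn_ge0//; exact: ltW.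
have [M QM] := body_bounded.
(* Boundedness of [Q] makes finitely many shells suffice. *)
have [K MK] : exists K, M < 2 ^+ K * T.
  exists (Num.trunc (M / T)).+1; rewrite -ltr_pdivrMr//.
  apply: lt_trans (truncnS_gt _) _.
  by rewrite -natrX ltr_nat ltn_expl.
rewrite -(ler_pM2r V0) sigma_sqr -lee_fin fineK//.
have mtail k : measurable (body_tail i (2 ^+ k * T) : set (borelRV R n)).
  exact: body_tail_borel.
pose F k (x : borelRV R n) : \bar R :=
  ((4 ^+ k.+1 * T ^+ 2)%:E * (\1_(body_tail i (2 ^+ k * T)) x)%:E)%E.
have F0 k x : (0 <= F k x)%E.
  by rewrite /F -EFinM lee_fin !mulr_ge0// ?exprn_ge0// ltW.
have mF (k : nat) : measurable_fun (Q : set (borelRV R n)) (F k).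
  apply: measurable_funeM; apply/measurable_EFinP; exact: measurable_indic.
apply: (@le_trans _ _ (\int[lebesgue_rV n]_(x in Q)
    ((cst (T ^+ 2)%:E x) + \sum_(k < K) F k x))%E).
  apply: ge0_le_integral => //.
  - by move=> x _; rewrite lee_fin sqr_ge0.
  - apply: emeasurable_funD; first exact: measurable_cst.
    by apply: emeasurable_sum => k; exact: mF.
  move=> x Qx; have {}MK : `|(x : 'rV[R]_n) 0 i| < 2 ^+ K * T.
    exact: le_lt_trans (QM _ Qx i) MK.
  elim: K MK => [|K IHK] xK.
    rewrite big_ord0 adde0 lee_fin -real_normK ?num_real//.
    by rewrite lerXn2r ?nnegrE ?(ltW T0)//; move: xK; rewrite mul1r => /ltW.
  have [xK'|xK'] := ltP `|(x : 'rV[R]_n) 0 i| (2 ^+ K * T).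
    by rewrite big_ord_recr/= addeA (le_trans (IHK xK'))// leeDl.
  rewrite big_ord_recr/= addeA (@le_trans _ _ (F K x))//; last first.
    by rewrite leeDr// adde_ge0 ?lee_fin ?sqr_ge0// sume_ge0.
  rewrite /F indicE mem_set ?mule1// lee_fin -real_normK ?num_real//.
  have -> : 4 ^+ K.+1 * T ^+ 2 = (2 ^+ K.+1 * T) ^+ 2.
    by rewrite exprMn -exprM mulnC exprM; congr (_ ^+ _ * _); ring.
  by rewrite lerXn2r ?nnegrE ?mulr_ge0 ?exprn_ge0 ?(ltW T0)// ltW.
rewrite ge0_integralD//; last 3 first.
- by move=> x _; rewrite lee_fin sqr_ge0.
- by move=> x _; apply: sume_ge0 => k _; exact: F0.
- by apply: emeasurable_sum => k; exact: mF.
rewrite integral_cst// ge0_integral_sum//.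
have IF (k : 'I_K) : (\int[lebesgue_rV n]_(x in Q) F k x =
    (4 ^+ k.+1 * T ^+ 2 * rvol (body_tail i (2 ^+ k * T)))%:E)%E.
  rewrite ge0_integralZl//; last 2 first.
  - apply/measurable_EFinP; exact: measurable_indic.
  - by rewrite lee_fin mulr_ge0 ?sqr_ge0 ?exprn_ge0.
  rewrite integral_indic// setIidl => [|x []//].
  rewrite [RHS]EFinM rvolK//; [exact: body_tail_borel|exact: body_tail_bounded].
under eq_bigr do rewrite IF.
rewrite sumEFin -[X in (_ * X + _)%E]/(vol Q) -(rvolK body_borel body_bounded).
rewrite -EFinM -EFinD lee_fin.
have E : \sum_(k < K) 4 ^+ k.+1 * T ^+ 2 * rvol (body_tail i (2 ^+ k * T)) <=
    \sum_(k < K) 2 ^- k.+1 * (T ^+ 2 * rvol Q).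
  apply: ler_sum => k _.
  have e8 : (8 : R) ^+ k.+1 = 4 ^+ k.+1 * 2 ^+ k.+1.
    by rewrite -exprMn; congr (_ ^+ _); ring.
  rewrite ler_pdivlMl ?exprn_gt0//.
  have := ler_wpM2l (sqr_ge0 T) (tailX k); rewrite e8; apply: le_trans.
  by rewrite le_eqVlt; apply/orP; left; apply/eqP; ring.
have S : \sum_(k < K) (2 : R) ^- k.+1 = 1 - 2 ^- K.
  elim: {mtail F F0 mF IF E MK} K => [|K IHK]; first by rewrite big_ord0 expr0 invr1 subrr.
  rewrite big_ord_recr/= IHK exprS invfM.
  by set z := _ ^- K; field.
move: E; rewrite -mulr_suml S => E.
have z0 : 0 <= (2 : R) ^- K by rewrite invr_ge0 exprn_ge0.
have TV : 0 <= T ^+ 2 * rvol Q by rewrite mulr_ge0 ?sqr_ge0 ?ltW.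
apply: le_trans (lerD (lexx _) E) _.
rewrite -[leRHS]mulrA; move: (mulr_ge0 z0 TV).
by set z := _ ^- K; set w := T ^+ 2 * rvol Q => zw; lra.
Qed.

Lemma sigma_gt0 i : 0 < sigma Q i.
Proof.
have [t t0 tV] := rvol_body_tail_gt0 i.
rewrite lt_neqAle sqrtr_ge0 andbT; apply/eqP => s0.
have := body_chebyshev i (ltW t0); rewrite -s0 expr0n/= mul0r leNgt.
by rewrite mulr_gt0// exprn_gt0.
Qed.

(** Otherwise [body_moment_le] at T = sigma / 2 would give sigma^2 <= sigma^2 / 2. *)
Lemma body_tail_lower i : rvol Q <= 8 * rvol (body_tail i (sigma Q i / 2)).
Proof.
have s0 := sigma_gt0 i; rewrite leNgt; apply/negP => /ltW.
have s20 : 0 < sigma Q i / 2 by rewrite divr_gt0.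
move=> /(body_moment_le s20).
have : 0 < sigma Q i ^+ 2 by rewrite exprn_gt0.
by rewrite exprMn; set z := sigma Q i ^+ 2; lra.
Qed.

(** * Slabs along the coordinate hyperplanes and the l1 bound *)

Let Qo := Q `&` orthant.

Let mQo : borel Qo.
Proof. by apply: measurableI; [exact: body_borel|exact: borel_orthant]. Qed.

Let bQo : coord_bounded Qo.
Proof. by apply: coord_boundedS body_bounded => x []. Qed.

Let Qo_gt0 : 0 < rvol Qo.
Proof.
have := rvol_body_gt0.
rewrite (rvol_orthant body_borel body_abs body_bounded) pmulr_rgt0//.
Qed.

Let slab i d := Qo `&` [set y : 'rV[R]_n | y 0 i < d].

Let mslab i d : borel (slab i d).
Proof. by apply: measurableI => //; exact: borel_coord_lt. Qed.

(** By [body_chebyshev] the slab of width T = 2 sigma holds at least 3/4 of Q+. Compressing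
    coordinate i by the factor d / T sends it into the slab of width d, by solidity, and 3/4 * d / T
    = 3/8 * d / sigma. *)
Let slab_lower i d : 0 < d -> d <= 2 * sigma Q i ->
  3 / 8 * (d / sigma Q i) * rvol Qo <= rvol (slab i d).
Proof.
move=> d0 dT; have s0 := sigma_gt0 i.
set T := 2 * sigma Q i in dT *.
have T0 : 0 < T by rewrite mulr_gt0.
have tail4 : 4 * rvol (body_tail i T `&` orthant) <= rvol Qo.
  have := body_chebyshev i (ltW T0).
  rewrite (rvol_orthant body_borel body_abs body_bounded).
  rewrite (rvol_orthant (body_tail_borel i T) _ (body_tail_bounded _ _)); last first.
    move=> x y xy [Qx Tx]; split; first exact: body_abs Qx.
    by rewrite /= -xy.
  rewrite mulrCA [leRHS]mulrCA ler_pM2l ?exprn_gt0// /T exprMn mulrAC mulrC.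
  by rewrite ler_pM2l ?exprn_gt0// -natrX mulrC.
have QoE : Qo `\` [set y : 'rV[R]_n | y 0 i < T] = body_tail i T `&` orthant.
  apply/seteqP; split => y /=.
    move=> [[Qy yo] /negP]; rewrite -leNgt => Ty; split => //; split => //=.
    by rewrite ger0_norm.
  move=> [[Qy /=]] + yo; rewrite ger0_norm// => Ty; split => //.
  by apply/negP; rewrite -leNgt.
have big : 3 / 4 * rvol Qo <= rvol (slab i T).
  have := rvolDI mQo (borel_coord_lt i T) bQo.
  rewrite QoE -/(slab i T); move: tail4.
  by set a := rvol Qo; set b := rvol (slab i T); lra.
pose c : 'rV[R]_n := \row_j (if j == i then T / d else 1).
have c1 j : 1 <= c 0 j.
  by rewrite mxE; case: ifP => // _; rewrite ler_pdivlMr// mul1r.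
have c0 j : 0 < c 0 j by rewrite (lt_le_trans _ (c1 j)).
have pc : \prod_j c 0 j = T / d.
  rewrite (bigD1 i)//= big1 ?mulr1; first by rewrite mxE eqxx.
  by move=> j /negbTE ji; rewrite mxE ji.
apply: (@le_trans _ _ (rvol (affine_rV c 0 @^-1` slab i T))).
  rewrite rvol_affine// pc invf_div.
  have -> : 3 / 8 * (d / sigma Q i) * rvol Qo = d / T * (3 / 4 * rvol Qo).
    by rewrite /T; field; exact: lt0r_neq0.
  by rewrite ler_wpM2l// divr_ge0// ltW.
apply: le_rvol => //; [|by apply: coord_boundedS bQo => x []|].
  by apply: borel_preimage => //; exact: continuous_affine_rV.
move=> y [[Qy yo] /=].
have aE j : affine_rV c 0 y 0 j = c 0 j * y 0 j.
  by rewrite mxE [(0 : 'rV[R]_n) 0 j]mxE addr0.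
have y0 j : 0 <= y 0 j by have := yo j; rewrite aE pmulr_rge0.
rewrite aE mxE eqxx mulrAC ltr_pdivrMr// ltr_pM2l// => yd.
split => //; split => //; apply: body_solid Qy => j.
rewrite aE !ger0_norm ?mulr_ge0 ?(ltW (c0 _))//.
by rewrite ler_peMl.
Qed.

(* Contracting Q+ towards x by the factor 1 - e lands in {y_i >= e x_i}, so the
   slabs {y_i < e x_i} together fill at most a fraction n e of Q+; their pairwise
   intersections are of order e^2. *)
Lemma body_l1 (x : 'rV[R]_n) : Q x ->
  \sum_i `|x 0 i| / sigma Q i <= 8 / 3 * n%:R.
Proof.
wlog x0 : x / forall i, 0 <= x 0 i.
  move=> H Qx; pose y : 'rV[R]_n := \row_i `|x 0 i|.
  have := H y; rewrite (eq_bigr (fun i => `|x 0 i| / sigma Q i)) => [|i _].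
    apply; first by move=> i; rewrite mxE.
    by apply: body_abs Qx => i; rewrite mxE normr_id.
  by rewrite mxE normr_id.
move=> Qx; have [M QM] := body_bounded.
have [M0|M0] := ltP M 0.
  rewrite big1 ?mulr_ge0// => i _; have := QM _ Qx i.
  by rewrite leNgt (lt_le_trans M0).
pose S := \sum_i x 0 i / sigma Q i.
pose K := n%:R ^+ 2 * M ^+ n.
have K0 : 0 <= K by rewrite mulr_ge0 ?sqr_ge0 ?exprn_ge0.
(* Small enough that e <= e0 gives e < 1 and e x_i <= 2 sigma_i, the range of [slab_lower]. *)
pose e0 : R := (1 + 1 + \sum_i M / (2 * sigma Q i))^-1.
have sM0 : 0 <= \sum_i M / (2 * sigma Q i).
  by rewrite sumr_ge0// => i _; rewrite divr_ge0// mulr_ge0// ltW// sigma_gt0.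
have e00 : 0 < e0 by rewrite invr_gt0; lra.
(* The overlaps of the slabs contribute the error K e, which is removed at the end by taking e
   arbitrarily small. *)
have main e : 0 < e -> e <= e0 -> 3 / 8 * S * rvol Qo <= n%:R * rvol Qo + K * e.
  move=> ep ee0.
  have e1 : e < 1.
    by rewrite (le_lt_trans ee0)// invf_lt1; lra.
  have eM i : e * x 0 i <= 2 * sigma Q i.
    have s0 := sigma_gt0 i.
    have xM : x 0 i <= M by have := QM _ Qx i; rewrite ger0_norm.
    apply: (@le_trans _ _ (e * M)); first by rewrite ler_pM2l.
    apply: (@le_trans _ _ (e0 * M)); first by rewrite ler_wpM2r.
    rewrite ler_pdivrMl; last lra.
    rewrite -ler_pdivrMr ?mulr_gt0//.
    rewrite [X in _ <= _ + X](bigD1 i)//=.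
    have : 0 <= \sum_(j < n | j != i) M / (2 * sigma Q j).
      by rewrite sumr_ge0// => j _; rewrite divr_ge0// mulr_ge0// ltW// sigma_gt0.
    by set a := \sum_(j < n | _) _; set b := M / _; lra.
  pose D := [set y : 'rV[R]_n | forall i, e * x 0 i <= y 0 i].
  have mD : borel D.
    have -> : D = \bigcap_(i in [set: 'I_n]) [set y : 'rV[R]_n | e * x 0 i <= y 0 i].
      by apply/seteqP; split => y /= h i; [move=> _|]; apply: h.
    rewrite /borel; apply: fin_bigcap_measurable => // i _.
    exact: borel_coord_le.
  have vD : (1 - n%:R * e) * rvol Qo <= rvol (Qo `&` D).
    apply: (@le_trans _ _ ((1 - e) ^+ n * rvol Qo)).
      by rewrite ler_pM2r// bernoulli_expr// !ltW.
    have c0 i : 0 < (const_mx (1 - e) : 'rV[R]_n) 0 i by rewrite mxE subr_gt0.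
    have mQD : borel (Qo `&` D) by exact: measurableI.
    have bQD : coord_bounded (Qo `&` D) by apply: coord_boundedS bQo => y [].
    have := rvol_affine (e *: x) c0 mQD.
    under eq_bigr do rewrite mxE.
    rewrite prodr_const card_ord => H.
    have ee : 0 < (1 - e) ^+ n by rewrite exprn_gt0// subr_gt0.
    rewrite -ler_pdivlMl// -H.
    have bpre : coord_bounded (affine_rV (const_mx (1 - e)) (e *: x) @^-1` (Qo `&` D)).
      exists (M / (1 - e)) => y [[Qy yo] yD] i.
      have y0 : 0 <= y 0 i.
        by have := yD i; rewrite !mxE lerDr pmulr_rge0 ?subr_gt0.
      rewrite ger0_norm// ler_pdivlMr ?subr_gt0//.
      have := QM _ Qy i; rewrite !mxE ger0_norm.
        by apply: le_trans; rewrite mulrC lerDl mulr_ge0// ltW.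
      by rewrite addr_ge0 ?mulr_ge0 ?subr_ge0 ?(ltW e1) ?(ltW ep).
    apply: le_rvol => //.
      by apply: borel_preimage => //; exact: continuous_affine_rV.
    move=> y [Qy yo]; have aE : affine_rV (const_mx (1 - e)) (e *: x) y =
        e *: x + (1 - e) *: y.
      by apply/rowP => i; rewrite !mxE addrC.
    rewrite /preimage/= aE; split; last first.
      by move=> i; rewrite !mxE lerDl mulr_ge0// subr_ge0 ltW.
    split; first by apply: body_conv => //; rewrite !ltW.
    by move=> i; rewrite !mxE addr_ge0 ?mulr_ge0 ?subr_ge0 ?(ltW e1) ?(ltW ep).
  have vDc : rvol (Qo `\` D) <= n%:R * e * rvol Qo.
    by have := rvolDI mQo mD bQo; move: vD; rewrite mulrBl mul1r; lra.
  have pair i j : i != j ->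
      rvol (slab i (e * x 0 i) `&` slab j (e * x 0 j)) <= M ^+ n * e ^+ 2.
    move=> ij.
    (* The two slabs meet inside a box with side e M in the directions i and j and side M in the
       others. *)
    pose b : 'rV[R]_n := \row_k (M * (if (k == i) || (k == j) then e else 1)).
    have b0 k : 0 <= b 0 k.
      by rewrite mxE mulr_ge0//; case: ifP => // _; exact: ltW.
    have pb : \prod_k b 0 k = M ^+ n * e ^+ 2.
      under eq_bigr do rewrite mxE.
      rewrite big_split/= prodr_const card_ord; congr (_ * _).
      rewrite (bigD1 i)//= eqxx (bigD1 j)/= 1?eq_sym// eqxx orbT big1 ?mulr1//.
      by move=> k /andP[/negbTE -> /negbTE ->].
    rewrite -lee_fin -pb rvolK; last 2 first.
    - by apply: measurableI; exact: mslab.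
    - by apply: coord_boundedS bQo => y [[]].
    have := @lebesgue_rV_box R n (const_mx 0) b.
    rewrite (eq_bigr (b 0)) => [|k _]; last first.
      by rewrite [(const_mx 0 : 'rV[R]_n) 0 k]mxE subr0.
    move=> <- => [|k]; last by rewrite [(const_mx 0 : 'rV[R]_n) 0 k]mxE.
    apply: le_vol; [by apply: measurableI; exact: mslab|exact: measurable_box|].
    move=> y [[[Qy yo] /= yi] [_ /= yj]] k; rewrite [(const_mx 0 : 'rV[R]_n) 0 k]mxE yo/= mxE.
    have xM l : e * x 0 l <= M * e.
      by rewrite mulrC ler_pM2r//; have := QM _ Qx l; rewrite ger0_norm.
    have [->|_] := eqVneq k i; first by rewrite /= (le_trans (ltW yi)).
    have [->|_] := eqVneq k j; first by rewrite /= (le_trans (ltW yj)).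
    by rewrite /= mulr1; have := QM _ Qy k; rewrite ger0_norm.
  have := @rvol_bonferroni R n n (fun i => slab i (e * x 0 i)) (Qo `\` D) (M ^+ n * e ^+ 2).
  move=> /(_ _ _ _ _ _ pair) H.
  have {}H : \sum_i rvol (slab i (e * x 0 i)) <= rvol (Qo `\` D) + n%:R ^+ 2 * (M ^+ n * e ^+ 2).
    apply: H => //.
    - by apply: measurableD; [exact: mQo|exact: mD].
    - by apply: coord_boundedS bQo => y [].
    - move=> i y [Qy /= yi]; split => // /(_ i); by rewrite leNgt yi.
    - by rewrite mulr_ge0 ?exprn_ge0// ltW.
  have low : \sum_i 3 / 8 * (e * x 0 i / sigma Q i) * rvol Qo <=
      \sum_i rvol (slab i (e * x 0 i)).
    apply: ler_sum => i _; have [xi0|xi0] := eqVneq (x 0 i) 0.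
      by rewrite xi0 mulr0 mul0r mulr0 mul0r rvol_ge0.
    by apply: slab_lower => //; rewrite mulr_gt0// lt_neqAle eq_sym xi0 x0.
  have lowE : \sum_i 3 / 8 * (e * x 0 i / sigma Q i) * rvol Qo = e * (3 / 8 * S * rvol Qo).
    by rewrite /S mulr_sumr mulr_suml mulr_sumr; apply: eq_bigr => i _; ring.
  rewrite -(ler_pM2l ep) -lowE (le_trans low)// (le_trans H)//.
  rewrite /K mulrDr (_ : e * (n%:R * rvol Qo) = n%:R * e * rvol Qo); last by ring.
  by rewrite lerD// le_eqVlt; apply/orP; left; apply/eqP; ring.
rewrite (eq_bigr (fun i => x 0 i / sigma Q i)) => [|i _]; last by rewrite ger0_norm.
rewrite -/S; suff : 3 / 8 * S * rvol Qo <= n%:R * rvol Qo.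
  by rewrite ler_pM2r//; lra.
apply/ler_addgt0Pr => d d0.
pose e := Num.min e0 (d / (K + 1)).
have K1 : 0 < K + 1 by rewrite ltr_wpDl.
have ep : 0 < e by rewrite lt_min e00 divr_gt0.
apply: le_trans (main e ep _) _; first by rewrite ge_min lexx.
rewrite lerD2l; apply: (@le_trans _ _ (K * (d / (K + 1)))).
  by rewrite ler_wpM2l// ge_min lexx orbT.
by rewrite mulrA ler_pdivrMr// mulrC ler_pM2l//; lra.
Qed.

End body.

(** * The norming functional *)

(** With m = n %/ 10, the levels k such that m < k < n - m number n - 2 m - 1; [window_level] lists
    them as m + 1 + j. The averaging uses that they are at least n / 2 in number. *)
Lemma window_size n : (5 <= n)%N -> (n <= 2 * (n - (n %/ 10).*2 - 1))%N.
Proof. by have := leq_trunc_div n 10; lia. Qed.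

Lemma window_level n m j : (j < n - m.*2 - 1)%N ->
  (m < m + 1 + j)%N /\ (m + 1 + j + m < n)%N.
Proof. lia. Qed.

Lemma exists_le_average (R : realType) N (f : 'I_N -> R) : (0 < N)%N ->
  exists j, N%:R * f j <= \sum_j f j.
Proof.
move=> N0; exists [arg min_(i < Ordinal N0) f i]%O.
case: arg_minP => // j _ fj.
rewrite mulr_natl -[N in _ *+ N]card_ord -sumr_const.
by apply: ler_sum => i _; exact: fj.
Qed.

Section norming.
Context {R : realType} {n : nat} (Q : set 'rV[R]_n) (lhat : {scalar 'rV[R]_n}).
Hypotheses (cQ : convex_body Q) (uQ : unconditional Q).
Hypothesis nQ : norming_functional Q lhat.

Definition ell (x : 'rV[R]_n) : R := lhat (x *m Lambda Q).

Let w i := lhat (delta_mx 0 i).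

Let q := gauge (hat Q) (const_mx 1).

Lemma Lambda_mulE (x : 'rV[R]_n) i : (x *m Lambda Q) 0 i = x 0 i / sigma Q i.
Proof. by rewrite /Lambda mul_mx_diag !mxE. Qed.

Let lhatE (x : 'rV[R]_n) : lhat x = \sum_i x 0 i * w i.
Proof.
by rewrite {1}[x]row_sum_delta linear_sum; apply: eq_bigr => i _; rewrite linearZ.
Qed.

Let ellE (x : 'rV[R]_n) : ell x = \sum_i x 0 i / sigma Q i * w i.
Proof. by rewrite /ell lhatE; apply: eq_bigr => i _; rewrite Lambda_mulE. Qed.

Lemma ellD x y : ell (x + y) = ell x + ell y.
Proof. by rewrite /ell mulmxDl linearD. Qed.

Lemma ellZ t x : ell (t *: x) = t * ell x.
Proof. by rewrite /ell -scalemxAl linearZ. Qed.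

Lemma continuous_ell : continuous ell.
Proof.
rewrite (_ : ell = fun x => \sum_i x 0 i / sigma Q i * w i); last first.
  by apply/funext => x; rewrite ellE.
apply: (@continuous_big R _ _ _ _ _ _ _ (fun i (y : 'rV[R]_n) => y 0 i / sigma Q i * w i)).
  exact: add_continuous.
move=> i _ x.
apply: (@continuousM R _ (fun y : 'rV[R]_n => y 0 i / sigma Q i) (fun=> w i));
  last exact: cst_continuous.
by apply: (@continuousM R _ (fun y : 'rV[R]_n => y 0 i) (fun=> (sigma Q i)^-1));
  [exact: coord_continuous|exact: cst_continuous].
Qed.

Lemma ell_le1 x : Q x -> `|ell x| <= 1.
Proof.
move=> Qx; have [dn _] := nQ; rewrite -dn /dual_norm.
set E := [set _ | _ in _].
(* A set without a supremum gets the default value 0, so the value 1 of [dual_norm] shows that the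
   set is bounded. *)
have hE : has_sup E.
  apply: contrapT => /sup_out; rewrite /E -/(dual_norm _ _) dn.
  by apply/eqP; rewrite oner_eq0.
by apply: (sup_upper_bound hE); exists (x *m Lambda Q) => //; exists x.
Qed.

(** If q were 0, its inverse would be 0 by convention, [ahat Q] would vanish, and lhat (ahat Q) = 1
    would fail. *)
Let q_gt0 : 0 < q.
Proof.
have [_ l1] := nQ; rewrite lt_neqAle; apply/andP; split.
  apply/eqP => q0; move: l1; rewrite /ahat -/q -q0 invr0 scale0r linear0.
  by move/eqP; rewrite eq_sym oner_eq0.
rewrite /q /gauge; set E := [set _ | _].
have [->|/set0P E0] := eqVneq E set0; first by rewrite inf0.
by apply: lb_le_inf => // a [/ltW].
Qed.

Let sum_w : \sum_i w i = q.
Proof.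
have [_] := nQ; rewrite /ahat -/q linearZ/= lhatE => /(congr1 ( *%R q)).
rewrite mulrA divff ?mul1r ?mulr1; last exact: lt0r_neq0.
by move=> <-; apply: eq_bigr => i _; rewrite mxE mul1r.
Qed.

(** The sum is the value of [ell] at the point with coordinates sg(w_i) |x_i|. As sg(w_i) may be 0,
    this point is in [Q] by solidity rather than by a mere sign change. *)
Let weighted_l1 x : Q x -> \sum_i `|w i| * (`|x 0 i| / sigma Q i) <= 1.
Proof.
move=> Qx; pose y : 'rV[R]_n := \row_i (Num.sg (w i) * `|x 0 i|).
have Qy : Q y.
  apply: (body_solid cQ uQ) Qx => i; rewrite mxE normrM normr_id normr_sg.
  by case: (w i != 0); rewrite ?mul1r// mul0r.
have := ell_le1 Qy; rewrite ellE (eq_bigr (fun i => `|w i| * (`|x 0 i| / sigma Q i))).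
  by apply: le_trans; rewrite ler_norm.
by move=> i _; rewrite mxE [`|w i|]normrEsg; ring.
Qed.

(* The functional sum_i |w_i| |x_i| / sigma_i is at most 1 on Q, while each
   |x_i| / sigma_i is at least 1/2 on an eighth of Q. *)
Lemma gauge_le16 : q <= 16.
Proof.
have V0 := rvol_body_gt0 cQ uQ.
pose T i := body_tail Q i (sigma Q i / 2).
have mT i : measurable (T i : set (borelRV R n)) by exact: body_tail_borel.
have mQ : measurable (Q : set (borelRV R n)) by exact: body_borel.
have I1 : (\int[lebesgue_rV n]_(x in Q)
    (\sum_(i < n) (`|w i| / 2)%:E * (\1_(T i) x)%:E) <= vol Q)%E.
  rewrite -[leRHS]mul1e /vol -integral_cst//.
  apply: ge0_le_integral => //.
  - by move=> x _; apply: sume_ge0 => i _; rewrite -EFinM lee_fin mulr_ge0.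
  - apply: emeasurable_sum => i; apply: measurable_funeM.
    by apply/measurable_EFinP; exact: measurable_indic.
  move=> x Qx; rewrite (eq_bigr (fun i => (`|w i| / 2 * \1_(T i) x)%:E))//.
  rewrite sumEFin lee_fin; apply: le_trans (weighted_l1 Qx).
  apply: ler_sum => i _; rewrite -mulrA ler_wpM2l// indicE.
  have s0 := sigma_gt0 cQ uQ i.
  have [/set_mem[_ /= xT]|_] := boolP (x \in T i).
    by rewrite mulr1 ler_pdivlMr// mulrC.
  by rewrite mulr0 divr_ge0// ltW.
have I2 : \sum_i `|w i| / 2 * rvol (T i) <= rvol Q.
  rewrite -lee_fin (rvolK (body_borel cQ) (body_bounded cQ)).
  apply: le_trans I1; rewrite ge0_integral_sum//; last first.
    move=> i; apply: measurable_funeM.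
    by apply/measurable_EFinP; exact: measurable_indic.
  rewrite -sumEFin le_eqVlt; apply/orP; left; apply/eqP; apply: eq_bigr => i _.
  rewrite ge0_integralZl//; last first.
    by apply/measurable_EFinP; exact: measurable_indic.
  rewrite integral_indic// setIidl => [|x []//].
  rewrite [LHS]EFinM rvolK//; [exact: body_tail_borel|exact: body_tail_bounded].
have I3 : \sum_i `|w i| / 16 * rvol Q <= rvol Q.
  apply: le_trans I2; apply: ler_sum => i _.
  have := ler_wpM2l (normr_ge0 (w i)) (body_tail_lower cQ uQ i).
  by rewrite -/(T i); set a := rvol Q; set b := rvol (T i); lra.
rewrite -sum_w; apply: (@le_trans _ _ (\sum_i `|w i|)).
  by apply: ler_sum => i _; exact: ler_norm.
by move: I3; rewrite -mulr_suml -mulr_suml -[leRHS]mul1r ler_pM2r// ler_pdivrMr// mul1r.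
Qed.

Lemma axisE i : axis Q 0 i = sigma Q i / q.
Proof.
have U : Lambda Q \in unitmx.
  rewrite unitmxE det_diag unitfE prodf_seq_neq0; apply/allP => j _ /=.
  by rewrite mxE invr_eq0 lt0r_neq0// sigma_gt0.
have := congr1 (fun z : 'rV[R]_n => z 0 i) (mulmxKV U (ahat Q)).
rewrite Lambda_mulE -/(axis Q) /ahat -/q !mxE mulr1 => H.
have s0 := lt0r_neq0 (sigma_gt0 cQ uQ i).
by rewrite -[LHS](divfK s0) H mulrC.
Qed.

Lemma ell_axis : ell (axis Q) = 1.
Proof.
rewrite ellE (eq_bigr (fun i => q^-1 * w i)) => [|i _]; last first.
  have s0 := lt0r_neq0 (sigma_gt0 cQ uQ i); have q0 := lt0r_neq0 q_gt0.
  by rewrite axisE; field; rewrite q0 s0.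
by rewrite -mulr_sumr sum_w mulVf// lt0r_neq0.
Qed.

(** The gauge is only an infimum, so t a_Q is first shown to be in [Q] for t < 1, and closedness
    gives t = 1. *)
Lemma axis_in_body : Q (axis Q).
Proof.
have lt1 t : 0 <= t -> t < 1 -> Q (t *: axis Q).
  move=> t0 t1; have q0 := q_gt0.
  pose E := [set a : R | 0 < a /\ dilate a (hat Q) (const_mx 1)].
  have hE : has_inf E.
    by apply: contrapT => /inf_out E0; move: q0; rewrite /q /gauge E0 ltxx.
  (* Such a candidate a of the gauge comes with the point y_i = sigma_i / a of [Q], which dominates
     t a_Q coordinatewise. *)
  have [a [a0 [_ [y Qy <-] /= ya]] aq] : exists2 a, E a & t * a <= q.
    have [->|tn0] := eqVneq t 0.
      by have [[a Ea] _] := hE; exists a => //; rewrite mul0r ltW.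
    have tp : 0 < t by rewrite lt_neqAle eq_sym tn0.
    have ep : 0 < q / t - q by rewrite subr_gt0 ltr_pdivlMr// gtr_pMr.
    have [a Ea aq] := inf_adherent ep hE; exists a => //.
    move: aq; rewrite -/(gauge (hat Q) _) -/q addrC subrK ltr_pdivlMr// mulrC.
    exact: ltW.
  apply: (body_solid cQ uQ) Qy => i; rewrite mxE axisE.
  have := congr1 (fun z : 'rV[R]_n => z 0 i) ya; rewrite !mxE.
  have := Lambda_mulE y i; rewrite mxE => -> /(canRL (mulKf (lt0r_neq0 a0))).
  have s0 := sigma_gt0 cQ uQ i; rewrite mulr1 => /(canRL (divfK (lt0r_neq0 s0))) ->.
  rewrite !ger0_norm ?mulr_ge0 ?invr_ge0 ?(ltW s0) ?(ltW a0) ?(ltW q0)//.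
  rewrite mulrCA mulrC ler_pM2r// ler_pdivrMr// mulrC ler_pdivlMr//.
apply: contrapT => nQa; have cl := body_closed cQ.
have oC : open ((fun t : R => t *: axis Q) @^-1` ~` Q).
  have /continuousP : continuous (fun t : R => t *: axis Q).
    by move=> t; exact: scalel_continuous.
  by apply; exact: closed_openC.
have /nbhs_ballP[e /= e0 eC] : nbhs (1 : R) ((fun t : R => t *: axis Q) @^-1` ~` Q).
  by apply: open_nbhs_nbhs; split => //=; rewrite scale1r.
pose t := Num.max 0 (1 - e / 2).
have t1 : t < 1 by rewrite gt_max ltr01/=; lra.
have t0 : 0 <= t by rewrite le_max lexx.
apply: (eC t) (lt1 t t0 t1); rewrite /ball/= ger0_norm ?subr_ge0 ?ltW//.
by have : 1 - e / 2 <= t by [rewrite le_max lexx orbT]; lra.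
Qed.

(** * Slices of the cylinder *)

Section bands.
Variable r : R.
Hypothesis r0 : 0 < r.

(* The slice s <= ell <= s' of the infinite cylinder R a_Q + r F_Q. *)
Definition band (s s' : R) : set 'rV[R]_n :=
  [set x | s <= ell x <= s' /\ Q (r^-1 *: (x - ell x *: axis Q))].

(** By [ell_axis] the point x - ell(x) a_Q is in the kernel of [ell], so the t and v of the
    construction are recovered from x as ell(x) and this component divided by r. *)
Lemma cylinder_band L : cylinder Q lhat L r = band (- L) L.
Proof.
apply/seteqP; split => [_ [t tL [v [Qv /= lv] <-]]|x [xL Qx]].
  have lt : ell (t *: axis Q + r *: v) = t.
    by rewrite ellD !ellZ ell_axis mulr1 [ell v]lv mulr0 addr0.
  move: tL; rewrite /= in_itv/= /band/= lt => tL; split => //.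
  by rewrite addrAC subrr add0r scalerA mulVf ?scale1r// lt0r_neq0.
exists (ell x) => /=; first by rewrite in_itv.
exists (r^-1 *: (x - ell x *: axis Q)).
  split => //=; rewrite -/(ell _) ellZ -scaleNr ellD ellZ ell_axis mulr1.
  by rewrite subrr mulr0.
by rewrite scalerA divff ?scale1r ?lt0r_neq0// addrC subrK.
Qed.

Lemma band_borel s s' : borel (band s s').
Proof.
apply: borel_closed.
rewrite (_ : band s s' = ell @^-1` `[s, s']%classic `&`
    (fun x : 'rV[R]_n => r^-1 *: (x - ell x *: axis Q)) @^-1` Q); last first.
  by apply/seteqP; split => x /=; rewrite in_itv.
apply: closedI.
  by apply: preimage_closed; [move=> x _; exact: continuous_ell|exact: interval_closed].
apply: preimage_closed; last exact: body_closed.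
suff cf : continuous (fun x : 'rV[R]_n => r^-1 *: (x - ell x *: axis Q)).
  by move=> x _; exact: cf.
apply: continuous_rV => i; under eq_fun do rewrite 4!mxE.
move=> x; apply: (@continuousM R _ (fun=> r^-1)
    (fun x : 'rV[R]_n => x 0 i - ell x * axis Q 0 i)).
  exact: cst_continuous.
apply: (@continuousB R R^o _ (fun x : 'rV[R]_n => x 0 i)
    (fun x => ell x * axis Q 0 i)); first exact: coord_continuous.
by apply: (@continuousM R _ ell (fun=> axis Q 0 i));
  [exact: continuous_ell|exact: cst_continuous].
Qed.

Lemma band_bounded s s' : coord_bounded (band s s').
Proof.
have [M QM] := body_bounded cQ.
exists (Num.max `|s| `|s'| * M + r * M) => x [xs Qx] i.
have -> : x = ell x *: axis Q + r *: (r^-1 *: (x - ell x *: axis Q)).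
  by rewrite scalerA divff ?scale1r ?lt0r_neq0// addrC subrK.
set y := _ *: (x - _) in Qx *; set t := ell x in xs *.
have -> : (t *: axis Q + r *: y) 0 i = t * axis Q 0 i + r * y 0 i.
  by rewrite [LHS]mxE [X in X + _ = _]mxE [X in _ + X = _]mxE.
apply: le_trans (ler_normD _ _) _; rewrite !normrM (gtr0_norm r0).
apply: lerD; last by rewrite ler_pM2l// QM.
apply: ler_pM => //; last exact/QM/axis_in_body.
rewrite le_max !ler_norml.
case: (lerP 0 t) => t0; apply/orP; [right|left].
  have s'0 : 0 <= s' by case/andP: xs => _; exact: le_trans.
  by rewrite ger0_norm//; lra.
have s0 : s <= 0 by case/andP: xs => + _ => /le_trans; apply; exact: ltW.
by rewrite ler0_norm//; lra.
Qed.

Lemma rvol_band_shift s s' d : rvol (band (s + d) (s' + d)) = rvol (band s s').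
Proof.
have := @rvol_affine R n (const_mx 1) (d *: axis Q) (band (s + d) (s' + d)).
rewrite big1 ?invr1 ?mul1r => [|i _]; last by rewrite mxE.
move=> <-; last 2 first.
- by move=> i; rewrite mxE.
- exact: band_borel.
congr rvol; apply/seteqP; split => x; rewrite /band /preimage/=;
  rewrite (_ : affine_rV _ _ x = x + d *: axis Q) ?ellD ?ellZ ?ell_axis ?mulr1;
  try (by apply/rowP => i; rewrite !mxE mul1r);
  rewrite scalerDl opprD addrACA subrr addr0 !lerD2r.
all: by [].
Qed.

Lemma rvol_band_double s d : 0 <= d ->
  rvol (band s (s + 2 * d)) <= 2 * rvol (band s (s + d)).
Proof.
move=> d0; set B := band s (s + 2 * d).
rewrite (@rvolDI R n B (band s (s + d))); [|exact: band_borel..|exact: band_bounded].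
rewrite mulr_natl mulr2n lerD//.
  rewrite -(rvol_band_shift s (s + d) d); apply: le_rvol.
  - by apply: measurableD; exact: band_borel.
  - exact: band_borel.
  - exact: band_bounded.
  - move=> x [[/andP[sx xs] Qx] nx]; split => //; apply/andP; split; last lra.
    rewrite leNgt; apply/negP => xd; apply: nx; split => //.
    by rewrite sx/= ltW.
apply: le_rvol.
- by apply: measurableI; exact: band_borel.
- exact: band_borel.
- exact: band_bounded.
- by move=> x [].
Qed.

(** Steps of 3 d between bands of width 2 d leave gaps of length d, so the closed translates are
    disjoint and [rvol_bonferroni] applies with p = 0. *)
Lemma rvol_band_pack s s' d J : 0 < d -> s + 3 * d * J%:R <= s' ->
  J%:R * rvol (band 0 (2 * d)) <= rvol (band s s').
Proof.
move=> dp ss'; have d0 := ltW dp.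
pose A (j : 'I_J) := band (0 + (s + 3 * d * j%:R)) (2 * d + (s + 3 * d * j%:R)).
have := @rvol_bonferroni R n J A (band s s') 0.
rewrite mulr0 addr0 (eq_bigr (fun=> rvol (band 0 (2 * d)))) => [|j _]; last first.
  exact: rvol_band_shift.
rewrite sumr_const card_ord [J%:R * _]mulr_natl; apply => //.
- by move=> j; exact: band_borel.
- exact: band_borel.
- exact: band_bounded.
- move=> j x [/andP[sx xs] Qx]; split => //; apply/andP; split.
    by rewrite (le_trans _ sx)// add0r lerDl !mulr_ge0.
  apply: le_trans xs _; apply: le_trans ss'.
  have : (j.+1)%:R <= J%:R :> R by rewrite ler_nat ltn_ord.
  by rewrite -natr1 => /(ler_wpM2l d0); set a : R := j%:R; set b : R := J%:R; lra.
move=> j k jk; rewrite (_ : _ `&` _ = set0) ?/rvol ?/vol ?measure0//.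
rewrite -subset0 => x [[/andP[j1 j2] _] [/andP[k1 k2] _]].
have far (i l : 'I_J) : (i < l)%N -> d * i%:R + d <= d * l%:R.
  by rewrite -(ler_nat R) -natr1 => /(ler_wpM2l d0); rewrite mulrDr mulr1.
move: j1 j2 k1 k2; move: jk; rewrite -val_eqE neq_ltn => /orP[/far|/far];
by set a : R := (nat_of_ord j)%:R; set b : R := (nat_of_ord k)%:R; lra.
Qed.

(* 1280 / 3 = 10 * 16 * (8 / 3): the 10 comes from n / 10, the rest from
   gauge_le16 and body_l1. *)
Variable c : R.
Hypothesis c_ge : 1280 <= 3 * c.

Let c_gt0 : 0 < c. Proof. by move: c_ge; lra. Qed.

Let cr_gt0 : 0 < c * r. Proof. exact: mulr_gt0. Qed.

(** * Layers with a given number of negative coordinates *)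

Definition negs (x : 'rV[R]_n) : nat := #|[pred i | x 0 i < 0]|.

Lemma borel_negs_ge k : borel [set x | (k <= negs x)%N].
Proof.
pose f (x : borelRV R n) : R := \sum_i \1_[set y : 'rV[R]_n | y 0 i < 0] x.
have mf : measurable_fun setT f.
  apply: measurable_sum => i; apply: measurable_indic; exact: borel_coord_lt.
have fE x : f x = (negs x)%:R.
  rewrite /f /negs -sum1_card natr_sum [RHS]big_mkcond; apply: eq_bigr => i _.
  rewrite indicE inE /=.
  have [xi|xi] := boolP ((x : 'rV[R]_n) 0 i < 0).
    by rewrite mem_set.
  by rewrite memNset//; exact/negP.
have -> : [set x | (k <= negs x)%N] = f @^-1` `[k%:R, +oo[%classic.
  by apply/seteqP; split => x /=; rewrite in_itv/= andbT fE ler_nat.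
by rewrite /borel -[X in measurable X]setTI; apply: mf => //; exact: measurable_itv.
Qed.

(** Markov's inequality for [body_l1]: c / 16 is at least 80 / 3, ten times the bound 8 / 3 on the
    average of |v_i| / sigma_i. *)
Lemma card_large (v : 'rV[R]_n) : Q v ->
  (#|[pred i | (c / 16 <= `|v 0 i| / sigma Q i)%R]| <= n %/ 10)%N.
Proof.
move=> Qv; set P := [pred i | _].
rewrite leq_divRL// -(ler_nat R) natrM.
have : c / 16 * #|P|%:R <= 8 / 3 * n%:R :> R.
  apply: le_trans (body_l1 cQ uQ Qv).
  rewrite mulr_natr -sumr_const big_mkcond/=; apply: ler_sum => i _.
  case: ifP => [|_] //.
  by rewrite divr_ge0// ltW// sigma_gt0.
have : 0 <= #|P|%:R :> R by [].
set p : R := #|P|%:R => p0; have := ler_wpM2r p0 c_ge; lra.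
Qed.

(** With t = ell(x) and v the transversal component, x_i = t sigma_i / q + r v_i. When x_i does not
    have the sign of t, r v_i has to offset t sigma_i / q, and q <= 16 makes |v_i| large. *)
Let tube_coord x i : c * r <= `|ell x| -> x 0 i * ell x <= 0 ->
  c / 16 <= `|(r^-1 *: (x - ell x *: axis Q)) 0 i| / sigma Q i.
Proof.
set v := _ *: _; set t := ell x => tr xt.
have s0 := sigma_gt0 cQ uQ i; have q0 := q_gt0.
have xE : x 0 i = t * (sigma Q i / q) + r * v 0 i.
  rewrite -axisE [v 0 i]mxE mulrA divff ?lt0r_neq0// mul1r.
  by rewrite [X in _ + X]mxE [X in _ + (_ + X)]mxE [X in _ + (_ + - X)]mxE addrC subrK.
rewrite ler_pdivlMr//; have q16 := gauge_le16.
have t0 : 0 < `|t| by exact: lt_le_trans tr.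
have h : `|t| * (sigma Q i / q) <= r * `|v 0 i|.
  rewrite -(ler_pM2r t0); move: xt; rewrite xE mulrDl.
  have -> : t * (sigma Q i / q) * t = `|t| * (sigma Q i / q) * `|t|.
    by rewrite mulrAC [RHS]mulrAC -!expr2 real_normK// num_real.
  have : - (r * v 0 i * t) <= r * `|v 0 i| * `|t|.
    by rewrite -{2}(gtr0_norm r0) -!normrM -normrN ler_norm.
  lra.
rewrite -(ler_pM2l r0); apply: le_trans h.
apply: (@le_trans _ _ (c * r * (sigma Q i / q))); last first.
  by rewrite ler_pM2r// divr_gt0.
have : sigma Q i / 16 <= sigma Q i / q by rewrite ler_pM2l// lef_pV2 ?posrE.
by move=> /(ler_wpM2l (ltW cr_gt0)); set b := _ / q; lra.
Qed.

(** Negative coordinates have the sign opposite to ell(x), so [tube_coord] places them among the few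
    that [card_large] allows. [negs_left] is the mirror image and counts the nonnegative
    coordinates. *)
Lemma negs_right s s' x : band s s' x -> c * r <= ell x -> (negs x <= n %/ 10)%N.
Proof.
move=> [_ Qx] tr; apply: leq_trans (card_large Qx); apply: subset_leq_card.
apply/fintype.subsetP => i; rewrite !inE => xi; apply: tube_coord.
  by rewrite (le_trans tr)// ler_norm.
rewrite mulr_le0_ge0//; first exact: ltW.
exact: le_trans (ltW cr_gt0) tr.
Qed.

Lemma negs_left s s' x : band s s' x -> ell x <= - (c * r) ->
  (n <= negs x + n %/ 10)%N.
Proof.
move=> [_ Qx] tr.
have := cardC [pred i | x 0 i < 0]; rewrite card_ord => {1}<-.
rewrite leq_add2l; apply: leq_trans (card_large Qx); apply: subset_leq_card.
apply/fintype.subsetP => i; rewrite !inE -leNgt => xi; apply: tube_coord.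
  by rewrite -normrN (le_trans _ (ler_norm _))// lerNr.
rewrite mulr_ge0_le0//.
by rewrite (le_trans tr)// oppr_le0 ltW.
Qed.

Lemma negs_axis_neighbor (x y : 'rV[R]_n) :
  (negs x <= negs y + #|[pred i | (x 0 i != y 0 i)%R]|)%N.
Proof.
apply: (@leq_trans #|[predU [pred i | y 0 i < 0] & [pred i | (x 0 i != y 0 i)%R]]|).
  apply: subset_leq_card; apply/fintype.subsetP => i; rewrite !inE => xi.
  by have [<-|_] := eqVneq (x 0 i) (y 0 i); [rewrite xi|rewrite orbT].
by rewrite -[leqRHS]cardUI leq_addr.
Qed.

(** The layers in the window share the band |ell| <= c r, and one of them is at most average. In 12
    = 2 * 6 the factor 2 comes from having at least n / 2 layers and the 6 from packing that
    band. *)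
Lemma exists_small_level (L : R) : (5 <= n)%N -> 3 * (c * r) <= L ->
  exists k, [/\ (n %/ 10 < k)%N, (k + n %/ 10 < n)%N &
    rvol (band (- L) L `&` [set x | negs x = k]) <=
      12 * (c * r) / (n%:R * L) * rvol (band (- L) L)].
Proof.
move=> n5 rL; set m := (n %/ 10)%N; set K := band (- L) L.
have nR0 : 0 < n%:R :> R by rewrite ltr0n; exact: leq_trans n5.
have d0 := cr_gt0.
have d3 : 0 < 3 * (c * r) by lra.
have L0 : 0 < L by lra.
pose N := (n - m.*2 - 1)%N.
have N2 : n%:R <= 2 * N%:R :> R.
  by rewrite -natrM ler_nat; exact: window_size.
have N0 : 0 < N%:R :> R by lra.
pose J := Num.trunc (L / (3 * (c * r))).
have y1 : 1 <= L / (3 * (c * r)) by rewrite (ler_pdivlMr _ _ d3); lra.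
have /andP[J1 J2] : J%:R <= L / (3 * (c * r)) < J.+1%:R.
  by apply: truncn_itv; exact: le_trans y1.
(* As L / (3 c r) >= 1, truncation loses at most a factor 2. *)
have J3 : L <= 6 * (c * r) * J%:R.
  have J0 : 1 <= J%:R :> R.
    by rewrite ler1n lt0n; apply/eqP => Jz; move: J2; rewrite Jz ltNge y1.
  have : L / (3 * (c * r)) <= 2 * J%:R by rewrite (le_trans (ltW J2))// -natr1; lra.
  by rewrite (ler_pdivrMr _ _ d3); lra.
have vB : rvol (band (- (c * r)) (c * r)) <= 6 * (c * r) / L * rvol K.
  have := @rvol_band_pack (- L) L (c * r) J d0.
  have -> : rvol (band 0 (2 * (c * r))) = rvol (band (- (c * r)) (c * r)).
    by rewrite -(rvol_band_shift _ (c * r) (c * r)) addNr -mulr2n mulr_natl.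
  move: J1; rewrite (ler_pdivlMr _ _ d3) => J1 /(_ _) H.
  have {}H : J%:R * rvol (band (- (c * r)) (c * r)) <= rvol K by apply: H; lra.
  have v0 := rvol_ge0 (band (- (c * r)) (c * r)).
  rewrite mulrAC ler_pdivlMr// mulrC.
  apply: le_trans (ler_wpM2r v0 J3) _.
  by rewrite -[leLHS]mulrA; apply: ler_wpM2l => //; rewrite mulr_ge0// ltW.
pose G (j : 'I_N) := K `&` [set x | negs x = (m + 1 + j)%N].
have mG j : borel (G j).
  have -> : G j = (K `&` [set x | (m + 1 + j <= negs x)%N]) `\`
      [set x | (m + 1 + j < negs x)%N].
    apply/seteqP; split => x /=; first by move=> [Kx ->]; rewrite ltnn leqnn.
    by move=> [[Kx h] /negP]; rewrite -leqNgt => h'; split => //=; apply/anti_leq/andP.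
  apply: measurableD; last exact: borel_negs_ge.
  by apply: measurableI; [exact: band_borel|exact: borel_negs_ge].
have GB j : G j `<=` band (- (c * r)) (c * r).
  move=> x [Kx /= xj]; have [_ Qx] := Kx; split => //.
  have [mj jm] := window_level (ltn_ord j).
  apply/andP; split; rewrite leNgt; apply/negP => /ltW h.
    by have := negs_left Kx h; rewrite xj leqNgt jm.
  by have := negs_right Kx h; rewrite xj leqNgt mj.
have sumG : \sum_j rvol (G j) <= rvol (band (- (c * r)) (c * r)).
  have := @rvol_bonferroni R n N G _ 0 mG (band_borel _ _) (band_bounded _ _) GB (lexx _).
  rewrite mulr0 addr0; apply => i j ij; rewrite (_ : _ `&` _ = set0) ?/rvol ?/vol ?measure0//.
  rewrite -subset0 => x [[_ /= xi] [_ /= xj]].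
  by move: ij; rewrite -val_eqE /=; move: xi; rewrite xj => /addnI ->; rewrite eqxx.
have Np : (0 < N)%N by rewrite -(ltr_nat R).
have [j /le_trans/(_ sumG) Gj] := exists_le_average (fun j => rvol (G j)) Np.
have [mj jm] := window_level (ltn_ord j).
exists (m + 1 + j)%N; split => //.
have g0 := rvol_ge0 (G j); rewrite -/(G j).
have h : n%:R * rvol (G j) <= 2 * (6 * (c * r) / L * rvol K).
  apply: (@le_trans _ _ (2 * (N%:R * rvol (G j)))); last first.
    by rewrite ler_pM2l//; exact: le_trans vB.
  by rewrite mulrA ler_wpM2r.
rewrite -(ler_pM2l nR0) (le_trans h)// le_eqVlt; apply/orP; left; apply/eqP.
by field; rewrite !lt0r_neq0.
Qed.

(** * End pieces, the two inclusions and the two axis-disjoint sets *)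

Lemma rvol_band_quarter s s' L : 0 <= L -> s' - s = L / 2 ->
  rvol (band (- L) L) <= 4 * rvol (band s s').
Proof.
move=> L0 ss'.
(* A shift along the axis moves the band to the left end, from where two doublings of its length
   cover everything. *)
have -> : rvol (band s s') = rvol (band (- L) (- L + L / 2)).
  rewrite -(rvol_band_shift s s' (- L - s)); congr (rvol (band _ _)); lra.
have h1 : 0 <= L / 2 by lra.
have := rvol_band_double (- L) h1; have := rvol_band_double (- L) L0.
rewrite (_ : - L + 2 * L = L); last by lra.
rewrite (_ : - L + 2 * (L / 2) = - L + L); last by lra.
lra.
Qed.

(** For y in [Q], both y and -ell(y) a_Q lie in [Q], hence so does half of y - ell(y) a_Q; this is
    the origin of r / 2. *)
Lemma dilate_sub_band L : r / 2 <= L -> dilate (r / 2) Q `<=` band (- L) L.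
Proof.
move=> rL _ [y Qy <-]; have y1 := ell_le1 Qy; split.
  rewrite -ler_norml ellZ normrM gtr0_norm ?divr_gt0//.
  by rewrite (le_trans _ rL)// ler_piMr// divr_ge0// ltW.
rewrite ellZ -(scalerA (r / 2) (ell y)) -scalerBr scalerA.
have -> : r^-1 * (r / 2) = 2^-1 by field; exact: lt0r_neq0.
have -> : 2^-1 *: (y - ell y *: axis Q) = 2^-1 *: y + (1 - 2^-1) *: (- ell y *: axis Q).
  by rewrite scalerBr scaleNr scalerN; congr (_ - _ *: _); field.
apply: (body_conv cQ) => //; last by lra.
apply: (body_solid cQ uQ) axis_in_body => i.
by rewrite mxE normrM normrN ler_piMl.
Qed.

Lemma band_sub_dilate L : 0 < L -> band (- L) L `<=` dilate (L + r) Q.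
Proof.
move=> L0 x [xL Qv]; set v := _ *: _ in Qv; set t := ell x in xL v Qv.
have xE : x = t *: axis Q + r *: v.
  by rewrite /v scalerA divff ?scale1r ?lt0r_neq0// addrC subrK.
rewrite xE; clearbody v t.
have Lr : 0 < L + r by rewrite addr_gt0.
(* t a_Q + r v is L + r times the convex combination of (t / L) a_Q and v with weights proportional
   to L and r. *)
exists ((L / (L + r)) *: ((t / L) *: axis Q) + (1 - L / (L + r)) *: v).
  apply: (body_conv cQ) => //; last first.
    by rewrite divr_ge0 ?(ltW L0) ?(ltW Lr)//= ler_pdivrMr// mul1r lerDl ltW.
  apply: (body_solid cQ uQ) axis_in_body => i.
  rewrite mxE normrM ler_piMl// normrM normfV (gtr0_norm L0) ler_pdivrMr// mul1r.
  by rewrite ler_norml.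
have -> : 1 - L / (L + r) = r / (L + r) by field; exact: lt0r_neq0.
rewrite scalerDr !scalerA.
have -> : (L + r) * (L / (L + r)) * (t / L) = t.
  by field; rewrite !lt0r_neq0.
by have -> : (L + r) * (r / (L + r)) = r by field; exact: lt0r_neq0.
Qed.

(** A and B are the two sides of the small layer. Since c r <= L / 2, A contains the end piece ell
    <= -L / 2 and B the end piece ell >= L / 2, each at least a quarter of the volume; the constant
    is 48 = 4 * 12. *)
Lemma band_cheeger (L : R) : (5 <= n)%N -> 3 * (c * r) <= L ->
  exists A B : set 'rV[R]_n,
    [/\ borel A /\ borel B,
        A `<=` band (- L) L /\ B `<=` band (- L) L,
        axis_disjoint A B,
        ((4^-1)%:E * vol (band (- L) L) <= mine (vol A) (vol B))%E &
        (vol (band (- L) L `\` (A `|` B)) / mine (vol A) (vol B)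
           <= (48 * (c * r) / (n%:R * L))%:E)%E].
Proof.
move=> n5 rL; have [k [mk kn Gk]] := exists_small_level n5 rL.
set K := band (- L) L in Gk *.
have cr0 := cr_gt0.
have L0 : 0 < L by lra.
have rc : r / 2 <= c * r by rewrite mulrC ler_pM2r//; move: c_ge; lra.
have mK : borel K by exact: band_borel.
have bK : coord_bounded K by exact: band_bounded.
pose A := K `&` [set x | (k.+1 <= negs x)%N].
pose B := K `\` [set x | (k <= negs x)%N].
have mA : borel A by apply: measurableI => //; exact: borel_negs_ge.
have mB : borel B by apply: measurableD => //; exact: borel_negs_ge.
have bA : coord_bounded A by apply: coord_boundedS bK => x [].
have bB : coord_bounded B by apply: coord_boundedS bK => x [].
have K0 : 0 < rvol K.
  have [d d0 dQ] := body_cube cQ uQ.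
  have r20 : 0 < r / 2 by rewrite divr_gt0.
  apply: (@rvol_box_gt0 _ _ _ (const_mx 0) (const_mx (r / 2 * d))) => //.
    by move=> i; rewrite !mxE mulr_gt0.
  move=> x xd; apply: (@dilate_sub_band L); first by lra.
  exists ((r / 2)^-1 *: x); last by rewrite scalerA divff ?scale1r ?lt0r_neq0.
  apply: dQ => i; have := xd i; rewrite !mxE => /andP[x0 xr].
  by rewrite ger0_norm ?mulr_ge0 ?invr_ge0 ?(ltW r20)// ler_pdivrMl.
have vA : rvol K <= 4 * rvol A.
  apply: le_trans (@rvol_band_quarter (- L) (- (L / 2)) L (ltW L0) _) _; first by lra.
  rewrite ler_pM2l//; apply: le_rvol => //; first exact: band_borel.
  move=> x Bx; have [/andP[x1 x2] Qx] := Bx; split.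
    by split => //; apply/andP; split; lra.
  rewrite /= -(ltn_add2r (n %/ 10)); apply: leq_trans kn _.
  by apply: (negs_left Bx); lra.
have vB : rvol K <= 4 * rvol B.
  apply: le_trans (@rvol_band_quarter (L / 2) L L (ltW L0) _) _; first by lra.
  rewrite ler_pM2l//; apply: le_rvol => //; first exact: band_borel.
  move=> x Bx; have [/andP[x1 x2] Qx] := Bx; split.
    by split => //; apply/andP; split; lra.
  apply/negP; rewrite -ltnNge; apply: leq_ltn_trans mk.
  by apply: (negs_right Bx); lra.
have gapE : K `\` (A `|` B) = K `&` [set x | negs x = k].
  apply/seteqP; split => x /=.
    move=> [Kx /not_orP[nA nB]]; split => //=; apply/anti_leq/andP; split.
      by rewrite leqNgt; apply/negP => h; apply: nA; split.
    by apply: contrapT => h; apply: nB; split.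
  move=> [Kx nk]; split => // -[[_ /=]|[_ /=]]; first by rewrite nk ltnn.
  by rewrite nk leqnn.
have mG : borel (K `\` (A `|` B)).
  by apply: measurableD => //; exact: measurableU.
have bG : coord_bounded (K `\` (A `|` B)) by apply: coord_boundedS bK => x [].
have minE : mine (vol A) (vol B) = (Num.min (rvol A) (rvol B))%:E.
  by rewrite -(rvolK mA bA) -(rvolK mB bB) EFin_min.
have Km : rvol K <= 4 * Num.min (rvol A) (rvol B).
  by rewrite minEle; case: ifP.
have m0 : 0 < Num.min (rvol A) (rvol B) by lra.
exists A, B; split => //.
- by split => x [].
(* The counts are at least k + 1 on A and at most k - 1 on B, so at least two coordinates differ. *)
- move=> x y [_ /= xk] [_ /= /negP]; rewrite -ltnNge => yk.
  rewrite -(leq_add2l (negs y)) addn2.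
  by apply: leq_trans (negs_axis_neighbor x y); apply: leq_trans xk; rewrite ltnS.
- by rewrite minE -(rvolK mK bK) -EFinM lee_fin ler_pdivrMl.
rewrite minE -(rvolK mG bG) gapE inver (gt_eqF m0) -EFinM lee_fin ler_pdivrMr//.
apply: le_trans Gk _.
have c0 : 0 <= 12 * (c * r) / (n%:R * L).
  by rewrite divr_ge0 ?mulr_ge0 ?(ltW r0) ?(ltW c_gt0) ?(ltW L0).
apply: le_trans (ler_wpM2l c0 Km) _.
by rewrite le_eqVlt; apply/orP; left; apply/eqP; ring.
Qed.

End bands.
End norming.

Unset Implicit Arguments.

Theorem proposition1p4 (R : realType) :
  exists C0 C c : R, [/\ 0 < C0, 0 < C, 0 < c &
    forall (n : nat) (Q : set 'rV[R]_n) (lhat : {scalar 'rV[R]_n}) (r L : R),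
      (5 <= n)%N -> convex_body Q -> unconditional Q ->
      norming_functional Q lhat -> 0 < r -> C0 * r <= L ->
      let K := cylinder Q lhat L r in
      [/\ dilate (r / 2) Q `<=` K,
          K `<=` dilate (L + r) Q &
          exists A B : set 'rV[R]_n,
            [/\ borel A /\ borel B,
                A `<=` K /\ B `<=` K,
                axis_disjoint A B,
                (c%:E * vol K <= mine (vol A) (vol B))%E &
                (vol (K `\` (A `|` B)) / mine (vol A) (vol B)
                   <= (C * r / (n%:R * L))%:E)%E]]].
Proof.
(* With the value 1280 / 3 for the constant of [c_ge], the first two are 3 and 48 times it; 1/4 is
   the share of an end piece. *)
exists 1280, (16 * 1280), 4^-1; split; [lra|lra|lra|].
move=> n Q lhat r L n5 cQ uQ nQ r0 rL.
have c_ge : 1280 <= 3 * (1280 / 3) :> R by lra.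
have cL : 3 * (1280 / 3 * r) <= L by lra.
rewrite (cylinder_band cQ uQ nQ r0) => K.
split; [apply: (dilate_sub_band cQ uQ nQ r0); lra| |].
  by apply: (band_sub_dilate cQ uQ nQ r0); lra.
have -> : 16 * 1280 * r / (n%:R * L) = 48 * (1280 / 3 * r) / (n%:R * L).
  by congr (_ / _); lra.
exact: (band_cheeger cQ uQ nQ r0 c_ge n5 cL).
Qed.
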